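(* Let $X$ be a completely regular space whose topology is generated by a family of pseudometrics $\Pi$. If $X$ is separable or possesses a countable collection of continuous functions separating points, then the weak topology coincides with the topology $\tau_{KR}$ on weakly compact sets in $\mathcal{M}_r(X)$.
   Context: A pseudometric differs from a metric in that it can be zero on distinct elements; the topology of a completely regular space is generated by a family of pseudometrics. A finite nonnegative Borel measure $\mu$ is Radon if for every Borel set $B$ and every $\varepsilon>0$ there is a compact set $K\subset B$ with $\mu(B\setminus K)<\varepsilon$; a signed Borel measure is Radon if its total variation is. $\mathcal{M}_r(X)$ is the linear space of all (signed) Radon measures on $X$. The weak topology on $\mathcal{M}_r(X)$ is generated by the seminorms $\mu\mapsto|\int_X f\,d\mu|$, $f\in C_b(X)$ (bounded continuous functions). For a pseudometric $p$, ${\rm Lip}_1(p)$ is the class of functions $f\colon X\to\mathbb{R}$ with $|f(x)-f(y)|\le p(x,y)$ for all $x,y$, and $\|\mu\|_{KR,p}=\sup\{\int_X f\,d\mu\colon f\in{\rm Lip}_1(p),\ |f|\le1\}$. The topology $\tau_{KR}$ on $\mathcal{M}_r(X)$ is generated by the seminorms $\|\cdot\|_{KR,p}$, $p\in\Pi$.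
   Formalization: The family Π is additionally assumed directed (for p, q in Π and e>0 some r in Π and d>0 have r<d implying p<e and q<e), its balls forming a neighbourhood base; for a mere generating subbase the claim fails, e.g. the two coordinate pseudometrics on the plane. *)

(* Defs.v *)
From HB Require Import structures.
From mathcomp Require Import all_boot all_order all_algebra.
From mathcomp Require Import all_classical all_reals all_analysis.

Set Implicit Arguments.
Unset Strict Implicit.
Unset Printing Implicit Defensive.

Import Order.TTheory GRing.Theory Num.Theory.
Import numFieldNormedType.Exports.

Local Open Scope classical_set_scope.
Local Open Scope ring_scope.

Section Spaces.
Context {R : realType}.

Definition separable_space (X : topologicalType) :=
  exists2 D : set X, countable D & dense D.

Definition countably_separated (X : topologicalType) :=
  exists F : set (X -> R), [/\ countable F, (forall f, F f -> continuous f)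
    & forall x y : X, x <> y -> exists2 f, F f & f x <> f y].

Definition is_pseudometric (X : Type) (p : X -> X -> R) :=
  [/\ forall x y, 0 <= p x y, forall x, p x x = 0,
      forall x y, p x y = p y x
    & forall x y z, p x z <= p x y + p y z].

(* The topology of X is the topology of the uniformity having the sets
   {(x, y) | p x y < e}, with p in Pi and e > 0, as a base. The second clause
   says that these sets form a filter base; it is weaker than Pi being closed
   under maxima, or directed for the pointwise order. A mere subbase would not
   do: for the two coordinate pseudometrics of the plane, every seminorm
   ||.||_{KR,p} vanishes on the measures with null marginals. *)
Definition generates_topology (X : topologicalType) (Pi : set (X -> X -> R)) :=
  [/\ forall p, Pi p -> is_pseudometric p,
      (forall p q (e : R), Pi p -> Pi q -> 0 < e ->
        exists r (d : R), [/\ Pi r, 0 < d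
          & forall x y, r x y < d -> p x y < e /\ q x y < e])
    & forall (x : X) (U : set X), nbhs x U <->
        exists p (e : R), [/\ Pi p, 0 < e & [set y | p x y < e] `<=` U]].

End Spaces.

Definition borel (X : ptopologicalType) := g_sigma_algebraType (@open X).

Section SignedMeasures.
Context {R : realType} {X : ptopologicalType}.
Implicit Types nu : {charge set (borel X) -> \bar R}.

Definition hahn_pos nu : set (borel X) := sval (cid (Hahn_decomposition nu)).

Definition hahn_neg nu : set (borel X) :=
  sval (cid (svalP (cid (Hahn_decomposition nu)))).

Definition hahnP nu : hahn_decomposition nu (hahn_pos nu) (hahn_neg nu) :=
  svalP (cid (svalP (cid (Hahn_decomposition nu)))).

Definition charge_integral nu (f : X -> R) : R :=
  (\int[jordan_pos (hahnP nu)]_x f x - \int[jordan_neg (hahnP nu)]_x f x)%R.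

(* X is not assumed to be Hausdorff, so that a compact set need not be Borel. *)
Definition radon_measure (mu : {measure set (borel X) -> \bar R}) :=
  forall (B : set (borel X)) (e : R), measurable B -> 0 < e ->
    exists K : set (borel X), [/\ compact (K : set X), measurable K, K `<=` B
      & (mu (B `\` K) < e%:E)%E].

Definition radon nu := radon_measure (charge_variation (hahnP nu)).

Definition csub (mu nu : {charge set (borel X) -> \bar R}) :
  {charge set (borel X) -> \bar R} := cadd mu (copp nu).

Definition bounded_continuous : set (X -> R) :=
  [set f | continuous f /\ bounded_fun f].

Definition Lip1 (p : X -> X -> R) : set (X -> R) :=
  [set f | forall x y, `|f x - f y| <= p x y].

Definition KR_seminorm (p : X -> X -> R) nu : R :=
  sup [set charge_integral nu f | f in
         [set f | Lip1 p f /\ forall x, `|f x| <= 1]].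

End SignedMeasures.

(* The space M_r(X). A charge also takes (irrelevant) values on sets that are
   not Borel: charges that agree on Borel sets represent the same measure, and
   no seminorm distinguishes them. *)
Record radon_charge (R : realType) (X : ptopologicalType) := RadonCharge {
  charge_of :> {charge set (borel X) -> \bar R} ;
  charge_of_radon : radon charge_of }.

HB.instance Definition _ R X := gen_eqMixin (radon_charge R X).
HB.instance Definition _ R X := gen_choiceMixin (radon_charge R X).

(* Q only serves to select the topology on radon_charge R X. *)
Definition seminorm_topology (R : realType) (X : ptopologicalType)
    (Q : set ({charge set (borel X) -> \bar R} -> R)) : Type :=
  radon_charge R X.

Section SeminormTopology.
Context {R : realType} {X : ptopologicalType}.
Variable Q : set ({charge set (borel X) -> \bar R} -> R).

Definition seminorm_balls : set (set (seminorm_topology Q)) :=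
  [set B | exists q (mu : radon_charge R X) (e : R), [/\ Q q, 0 < e
    & B = [set nu : radon_charge R X | q (csub nu mu) < e]]].

HB.instance Definition _ := Choice.copy (seminorm_topology Q) (radon_charge R X).
HB.instance Definition _ :=
  isSubBaseTopological.Build (seminorm_topology Q) seminorm_balls id.

End SeminormTopology.
Arguments seminorm_balls {R X} Q _.

Definition weak_topology (R : realType) (X : ptopologicalType) :=
  seminorm_topology (R := R) (X := X)
    [set (fun nu => `|charge_integral nu f|) | f in bounded_continuous].

Definition KR_topology (R : realType) (X : ptopologicalType)
    (Pi : set (X -> X -> R)) :=
  seminorm_topology [set @KR_seminorm R X p | p in Pi].

HB.instance Definition _ R X := Topological.on (weak_topology R X).
HB.instance Definition _ R X Pi := Topological.on (@KR_topology R X Pi).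

Definition weakly_compact (R : realType) (X : ptopologicalType)
    (A : set (radon_charge R X)) :=
  compact (A : set (weak_topology R X)).

Definition trace_opens (T : topologicalType) (A : set T) : set (set T) :=
  [set A `&` U | U in @open T].

(* Main.v *)
Require Import Defs.
From HB Require Import structures.
From mathcomp Require Import all_boot all_order all_algebra.
From mathcomp Require Import all_classical all_reals all_analysis.
From mathcomp Require Import measurable_realfun ring lra.
Set Implicit Arguments.
Unset Strict Implicit.
Unset Printing Implicit Defensive.
Import Order.TTheory GRing.Theory Num.Theory.
Import numFieldNormedType.Exports.
Local Open Scope classical_set_scope.
Local Open Scope ring_scope.

(** The identity from the weak to the KR topology is continuous on a weakly
    compact set [A]; as KR separates the points of the weak topology, the
    inverse is continuous too, by compactness of [A].

    KR separates points: a Radon charge is carried, up to [e], by disjoint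
    compact subsets of its Hahn sets, and a Lipschitz function equal to [1] on
    one and [-1] on the other has integral at least [tv - e].

    Continuity: fix [p] and [mu] in [A]. Separability (of [X], or of the
    pseudometrics [max_(i < n) |phi_i x - phi_i y|]) yields countably many
    bounded continuous functions that determine the integrals of all bounded
    [p]-Lipschitz functions. If continuity failed, some sequence [s k] in [A]
    far from [mu] in KR would converge to [mu] on this countable family, hence,
    by weak compactness, on each bounded [p]-Lipschitz function; its variations
    are bounded by the uniform boundedness principle. A gliding hump now gives a
    contradiction, as for the Schur property: humps of 1-Lipschitz functions
    almost carried by far apart totally bounded sets can be added up into a
    single Lipschitz function whose integrals do not converge. *)

(** * Integration against a charge *)

Section charge_integral.
Context {R : realType} {X : ptopologicalType}.
Implicit Types (nu mu : {charge set (borel X) -> \bar R}) (f g : X -> R).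

Definition bounded_measurable f :=
  measurable_fun [set: borel X] (f : borel X -> R) /\
  exists b, forall x, `|f x| <= b.

(** The variation of a charge is a finite measure, so that [fine] loses nothing on Borel sets. *)
Definition tv nu (B : set (borel X)) : R := fine (charge_variation (hahnP nu) B).

Lemma bounded_measurable_integrable (m : {finite_measure set (borel X) -> \bar R}) f :
  bounded_measurable f -> m.-integrable [set: borel X] (EFin \o f).
Proof.
move=> [mf [b fb]]; apply: measurable_bounded_integrable => //.
- by rewrite ltey_eq fin_num_measure.
- by exists b; split; [exact: num_real|move=> M bM x _; exact: le_trans (fb x) (ltW bM)].
Qed.

Lemma continuous_measurable f : continuous f ->
  measurable_fun [set: borel X] (f : borel X -> R).
Proof.
move=> cf; apply: (measurability _ (RGenOpens.measurableE R)).
move=> _ [_ [a [b ->] <-]]; rewrite setTI; apply: sub_sigma_algebra.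
by move/continuousP : cf; apply; exact: interval_open.
Qed.

Lemma charge_integralD nu f g : bounded_measurable f -> bounded_measurable g ->
  charge_integral nu (fun x => f x + g x)
  = charge_integral nu f + charge_integral nu g.
Proof.
move=> bf bg; rewrite /charge_integral !RintegralD//;
  do ?exact: bounded_measurable_integrable.
by rewrite opprD addrACA.
Qed.

Lemma charge_integralZ nu f c : bounded_measurable f ->
  charge_integral nu (fun x => c * f x) = c * charge_integral nu f.
Proof.
move=> bf; rewrite /charge_integral !RintegralZl//;
  do ?exact: bounded_measurable_integrable.
by rewrite mulrBr.
Qed.


(** Integrate the bound of [|f|] by [a] plus [b] times the indicator of the complement of [B]
    against both Jordan parts. This is the basic estimate below: [f] is small on [B], and merely
    bounded where the charge has little mass. *)
Lemma charge_integral_bound nu f (B : set (borel X)) a b :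
  measurable_fun [set: borel X] (f : borel X -> R) ->
  measurable B -> 0 <= a -> 0 <= b ->
  (forall x, `|f x| <= b) -> (forall x, B x -> `|f x| <= a) ->
  `|charge_integral nu f| <= a * tv nu setT + b * tv nu (~` B).
Proof.
move=> mf mB a0 b0 fb fa.
have bf : bounded_measurable f by split => //; exists b.
have mB' : measurable (~` B) by exact: measurableC.
have bg : bounded_measurable (fun x => a + b * \1_(~` B) x).
  split.
    apply: measurable_funD => //; apply: measurable_funM => //.
  exists (`|a| + b) => x; apply: le_trans (ler_normD _ _) _.
  rewrite lerD2l normrM (ger0_norm b0) ler_piMr//.
  by rewrite indicE; case: (_ \in _); rewrite ?normr1 ?normr0.
have key (m : {finite_measure set (borel X) -> \bar R}) :
    `|\int[m]_x f x| <= a * fine (m setT) + b * fine (m (~` B)).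
  apply: le_trans (le_normr_Rintegral _ (bounded_measurable_integrable m bf)) _ => //.
  have -> : a * fine (m setT) + b * fine (m (~` B)) =
      \int[m]_x (a + b * \1_(~` B) x).
    rewrite RintegralD//; last 2 first.
    - apply: (@bounded_measurable_integrable m (cst a)).
      by split; [exact: measurable_cst|exists `|a|].
    - apply: (@bounded_measurable_integrable m (fun x => b * \1_(~` B) x)).
      split; first exact: measurable_funM.
      exists b => x; rewrite normrM (ger0_norm b0) ler_piMr//.
      by rewrite indicE; case: (_ \in _); rewrite ?normr1 ?normr0.
    rewrite Rintegral_cst// RintegralZl//.
      by rewrite /Rintegral integral_indic// setIT.
    apply: (@bounded_measurable_integrable m (\1_(~` B))).
    split; first exact: measurable_indic.
    by exists 1 => x; rewrite indicE; case: (_ \in _); rewrite ?normr1 ?normr0.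
  apply: le_Rintegral => //.
  - apply: (@bounded_measurable_integrable m (fun x => `|f x|)).
    split; first exact: measurableT_comp.
    by exists b => x; rewrite normr_id.
  - exact: (bounded_measurable_integrable m bg).
  - move=> x _; rewrite indicE; have [xB|xB] := pselect (B x).
      by rewrite memNset ?mulr0 ?addr0; [exact: fa|move=> /(_ xB)].
    rewrite mem_set// mulr1.
    by rewrite (le_trans (fb x))// lerDr.
rewrite /charge_integral (le_trans (ler_normB _ _))//.
apply: le_trans (lerD (key _) (key _)) _.
rewrite /tv /charge_variation /= !fineD ?fin_num_measure// !mulrDr addrACA; exact: lexx.
Qed.


Lemma tv_ge0 nu B : 0 <= tv nu B.
Proof. by rewrite fine_ge0. Qed.

Lemma le_tv nu (A B : set (borel X)) : measurable A -> measurable B ->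
  A `<=` B -> tv nu A <= tv nu B.
Proof.
by move=> mA mB AB; rewrite fine_le ?fin_num_measure// le_measure ?inE.
Qed.


Lemma radon_tv nu (B : set (borel X)) e : radon nu -> measurable B -> 0 < e ->
  exists K : set (borel X), [/\ compact (K : set X), measurable K, K `<=` B
    & tv nu (B `\` K) < e].
Proof.
move=> rnu mB e0; have [K [cK mK KB nuK]] := rnu B e mB e0.
exists K; split => //; rewrite -lte_fin fineK ?fin_num_measure//.
exact: measurableD.
Qed.

Lemma charge_fineE nu (A : set (borel X)) : measurable A ->
  fine (nu A) = fine (jordan_pos (hahnP nu) A) - fine (jordan_neg (hahnP nu) A).
Proof.
move=> mA; rewrite [in LHS](jordan_decomp (hahnP nu) mA) /cadd/= cscaleN1.
by rewrite fineD ?fin_num_measure ?fin_numN ?fin_num_measure// fineN.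
Qed.

Lemma fine_csub mu nu (A : set (borel X)) : measurable A ->
  fine (csub mu nu A) = fine (mu A) - fine (nu A).
Proof.
move=> mA; rewrite /csub /cadd /copp /=.
by rewrite fineD ?fin_numN ?fin_num_measure// fineN.
Qed.

Lemma integral_bounded_measurable_add (m1 m2 : {measure set (borel X) -> \bar R}) f :
  (m1 setT < +oo)%E -> (m2 setT < +oo)%E -> bounded_measurable f ->
  (\int[measure_add m1 m2]_x (f x)%:E = \int[m1]_x (f x)%:E + \int[m2]_x (f x)%:E)%E.
Proof.
move=> f1 f2 [mf [b fb]]; rewrite integral_measure_add//;
  do ?[exact/measurable_EFinP|apply: measurable_bounded_integrable => //;
  exists b; split; [exact: num_real|move=> M bM x _; exact: le_trans (fb x) (ltW bM)]].
Qed.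

(** The Hahn sets of a difference are unrelated to those of its terms. The identity is therefore
    rearranged into one between sums of positive measures, which is checked set by set: [c]
    positive, [mu] negative and [nu] positive on one side, the opposite parts on the other. *)
Lemma charge_integral_csub mu nu f : bounded_measurable f ->
  charge_integral (csub mu nu) f = charge_integral mu f - charge_integral nu f.
Proof.
move=> bf; rewrite /charge_integral.
set c := csub mu nu.
have : \int[measure_add (jordan_pos (hahnP c))
      (measure_add (jordan_neg (hahnP mu)) (jordan_pos (hahnP nu)))]_x f x
   = \int[measure_add (jordan_neg (hahnP c))
      (measure_add (jordan_pos (hahnP mu)) (jordan_neg (hahnP nu)))]_x f x.
  congr fine; apply: eq_measure_integral => A mA _.
  have h (m : {finite_measure set (borel X) -> \bar R}) : m A = (fine (m A))%:E.
    by rewrite fineK ?fin_num_measure.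
  have E (m1 m2 m3 : {finite_measure set (borel X) -> \bar R}) :
      measure_add m1 (measure_add m2 m3) A =
      (fine (m1 A) + (fine (m2 A) + fine (m3 A)))%:E.
    by rewrite !EFinD -!h measure_addE; congr (_ + _)%E; exact: measure_addE.
  apply: etrans (E _ _ _) _; apply: etrans (esym (E _ _ _)); congr EFin.
  have ar (a b a' b' s t : R) : a - b = a' - b' - (s - t) ->
    a + (b' + s) = b + (a' + t) by lra.
  apply: ar; have := fine_csub mu nu mA.
  rewrite (charge_fineE c)// (charge_fineE mu)// (charge_fineE nu)//.
have E (m1 m2 m3 : {finite_measure set (borel X) -> \bar R}) :
    \int[measure_add m1 (measure_add m2 m3)]_x f x =
    \int[m1]_x f x + (\int[m2]_x f x + \int[m3]_x f x).
  have mT (m : {finite_measure set (borel X) -> \bar R}) : (m setT < +oo)%E.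
    by rewrite ltey_eq fin_num_measure.
  have fi (m : {finite_measure set (borel X) -> \bar R}) :
      (\int[m]_x (f x)%:E)%E \is a fin_num.
    by apply: integrable_fin_num => //; exact: bounded_measurable_integrable.
  have h := integral_bounded_measurable_add (mT m2) (mT m3) bf.
  have m23 : (measure_add m2 m3 setT < +oo)%E.
    by rewrite [ltLHS](measure_addE m2 m3); exact: lte_add_pinfty (mT m2) (mT m3).
  have g := integral_bounded_measurable_add (mT m1) m23 bf.
  apply: etrans (congr1 fine (etrans g (congr1 _ h))) _.
  have ar (u v w : \bar R) : u \is a fin_num -> v \is a fin_num ->
      w \is a fin_num -> fine (u + (v + w)) = fine u + (fine v + fine w).
    by move: u v w => [u| |] [v| |] [w| |].
  exact: ar (fi _) (fi _) (fi _).
have ar (a b a' b' s t : R) : a + (b' + s) = b + (a' + t) ->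
  a - b = a' - b' - (s - t) by lra.
by move=> e; apply: ar; exact: etrans (esym (E _ _ _)) (etrans e (E _ _ _)).
Qed.

Lemma measurable_hahn_pos nu : measurable (hahn_pos nu).
Proof. by have [[]] := hahnP nu. Qed.

Lemma measurable_hahn_neg nu : measurable (hahn_neg nu).
Proof. by have [_ []] := hahnP nu. Qed.

Lemma fine_jordan_pos nu (A : set (borel X)) : measurable A ->
  fine (jordan_pos (hahnP nu) A) = fine (nu (A `&` hahn_pos nu)).
Proof. by move=> mA; rewrite jordan_posE cjordan_posE /crestr0 mem_set. Qed.

Lemma fine_jordan_neg nu (A : set (borel X)) : measurable A ->
  fine (jordan_neg (hahnP nu) A) = - fine (nu (A `&` hahn_neg nu)).
Proof.
move=> mA; rewrite jordan_negE cjordan_negE /crestr0 mem_set// /crestr fineN//.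
Qed.

Lemma tvE nu (A : set (borel X)) : measurable A ->
  tv nu A = fine (jordan_pos (hahnP nu) A) + fine (jordan_neg (hahnP nu) A).
Proof. by move=> mA; rewrite /tv /charge_variation /= fineD ?fin_num_measure. Qed.

Lemma normr_charge_le_tv nu (A : set (borel X)) : measurable A ->
  `|fine (nu A)| <= tv nu A.
Proof.
move=> mA; rewrite tvE// charge_fineE// (le_trans (ler_normB _ _))//.
by rewrite !ger0_norm ?fine_ge0.
Qed.

Lemma tv_split nu (P N A : set (borel X)) : measurable P -> measurable N ->
  P `|` N = setT -> P `&` N = set0 -> measurable A ->
  tv nu A = tv nu (A `&` P) + tv nu (A `&` N).
Proof.
move=> mP mN PN PN0 mA; rewrite -fineD ?fin_num_measure//;
  do ?exact: measurableI.
rewrite -measureU//; do ?exact: measurableI.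
  by rewrite -setIUr PN setIT.
by rewrite setIACA PN0 setI0.
Qed.

(** Both charges are evaluated on the two pieces into which the Hahn sets of the difference cut
    [B]. *)
Lemma tv_csub mu nu (B : set (borel X)) : measurable B ->
  tv (csub mu nu) B <= tv mu B + tv nu B.
Proof.
move=> mB; set c := csub mu nu.
have mP := measurable_hahn_pos c; have mN := measurable_hahn_neg c.
have [_ _ PN PN0] := hahnP c.
have mBP : measurable (B `&` hahn_pos c) by exact: measurableI.
have mBN : measurable (B `&` hahn_neg c) by exact: measurableI.
rewrite tvE// fine_jordan_pos// fine_jordan_neg// !fine_csub//.
rewrite (tv_split mu mP mN PN PN0 mB) (tv_split nu mP mN PN PN0 mB).
have ar (a b a' b' s s' t t' : R) : `|a| <= s -> `|b| <= t -> `|a'| <= s' ->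
    `|b'| <= t' -> a - b - (a' - b') <= s + s' + (t + t').
  rewrite !ler_norml => /andP[? ?] /andP[? ?] /andP[? ?] /andP[? ?]; lra.
by apply: ar; exact: normr_charge_le_tv.
Qed.

Lemma radon_csub mu nu : radon mu -> radon nu -> radon (csub mu nu).
Proof.
move=> rmu rnu B e mB e0.
have e20 : 0 < e / 2 by rewrite divr_gt0.
have [K [cK mK KB muK]] := radon_tv rmu mB e20.
have [L [cL mL LB nuL]] := radon_tv rnu mB e20.
exists (K `|` L); split.
- exact: compactU.
- exact: measurableU.
- by rewrite subUset.
have mKL : measurable (B `\` (K `|` L)) by apply: measurableD => //; exact: measurableU.
rewrite -[X in (X < _)%E]fineK ?fin_num_measure// lte_fin.
apply: le_lt_trans (tv_csub _ _ mKL) _.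
rewrite (splitr e) ltrD//.
- apply: le_lt_trans muK; apply: le_tv => //; first exact: measurableD.
  by apply: setDS; exact: subsetUl.
- apply: le_lt_trans nuL; apply: le_tv => //; first exact: measurableD.
  by apply: setDS; exact: subsetUr.
Qed.

(** Off [K] the function [f] falls below 1 by at most 2, and so does [- f] off [L]. The positive
    part sees the complement of [K] only inside [hahn_pos nu], and the negative part that of [L]
    only inside [hahn_neg nu]. *)
Lemma charge_integral_ge_tv nu f (K L : set (borel X)) :
  bounded_measurable f -> measurable K -> measurable L ->
  (forall x, `|f x| <= 1) -> (forall x, K x -> f x = 1) ->
  (forall x, L x -> f x = - 1) ->
  tv nu setT - 2 * (tv nu (hahn_pos nu `\` K) + tv nu (hahn_neg nu `\` L))
    <= charge_integral nu f.
Proof.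
move=> bf mK mL f1 fK fL.
have mP := measurable_hahn_pos nu; have mN := measurable_hahn_neg nu.
have [_ _ PN PN0] := hahnP nu.
have key (m : {finite_measure set (borel X) -> \bar R}) g (A : set (borel X)) :
    bounded_measurable g -> measurable A -> (forall x, `|g x| <= 1) ->
    (forall x, A x -> g x = 1) ->
    fine (m setT) - 2 * fine (m (~` A)) <= \int[m]_x g x.
  move=> bg mA g1 gA; have mA' : measurable (~` A) by exact: measurableC.
  have bh : bounded_measurable (fun x => \1_(~` A) x : R).
    split; first exact: measurable_indic.
    by exists 1 => x; rewrite indicE; case: (_ \in _); rewrite ?normr1 ?normr0.
  have b1 : bounded_measurable (cst 1 : X -> R).
    by split; [exact: measurable_cst|exists `|1|].
  have b2 : bounded_measurable (fun x => 2 * \1_(~` A) x : R).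
    split; first by apply: measurable_funM => //; case: bh.
    exists 2 => x; rewrite indicE; case: (_ \in _);
    by rewrite ?mulr1 ?mulr0 ?normr0// ger0_norm.
  have -> : fine (m setT) - 2 * fine (m (~` A)) =
      \int[m]_x (1 - 2 * \1_(~` A) x).
    rewrite RintegralB//; last 2 first.
    - exact: (bounded_measurable_integrable m b1).
    - exact: (bounded_measurable_integrable m b2).
    rewrite Rintegral_cst// mul1r RintegralZl//.
      by rewrite /Rintegral integral_indic// setIT.
    exact: (bounded_measurable_integrable m bh).
  apply: le_Rintegral => //.
  - apply: (@bounded_measurable_integrable m (fun x => 1 - 2 * \1_(~` A) x)).
    split; first by apply: measurable_funB => //; case: b2.
    exists 1 => x; rewrite indicE; case: (_ \in _);
    by rewrite ?mulr1 ?mulr0 ?subr0 ?normr1// opprD addrA subrr sub0r normrN1.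
  - exact: bounded_measurable_integrable.
  - move=> x _; rewrite indicE; have [xA|xA] := pselect (A x).
      by rewrite memNset ?mulr0 ?subr0 ?gA//; exact.
    rewrite mem_set// mulr1; have := g1 x; rewrite ler_norml => /andP[? _]; lra.
have mK' : measurable (~` K) by exact: measurableC.
have mL' : measurable (~` L) by exact: measurableC.
have bg : bounded_measurable (fun x => -1 * f x).
  split; first by apply: measurable_funM => //; case: bf.
  by exists 1 => x; rewrite mulN1r normrN.
have hK := key (jordan_pos (hahnP nu)) f K bf mK f1 fK.
have := key (jordan_neg (hahnP nu)) (fun x => -1 * f x) L bg mL.
rewrite RintegralZl//; last exact: bounded_measurable_integrable.
move=> /(_ _ _)/wrap[]; first by move=> x; rewrite mulN1r normrN.
  by move=> x /fL ->; rewrite mulN1r opprK.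
have pK : fine (jordan_pos (hahnP nu) (~` K)) <= tv nu (hahn_pos nu `\` K).
  rewrite fine_jordan_pos// setIC -setDE.
  exact: le_trans (ler_norm _) (normr_charge_le_tv _ (measurableD _ _)).
have nL : fine (jordan_neg (hahnP nu) (~` L)) <= tv nu (hahn_neg nu `\` L).
  rewrite fine_jordan_neg// setIC -setDE; apply: le_trans (ler_norm _) _.
  by rewrite normrN; exact: (normr_charge_le_tv _ (measurableD _ _)).
have ar (p n p' n' s t a b : R) : p - 2 * p' <= a -> n - 2 * n' <= -1 * b ->
  p' <= s -> n' <= t -> p + n - 2 * (s + t) <= a - b by lra.
by move=> hL; rewrite /charge_integral tvE//; exact: ar hK hL pK nL.
Qed.

End charge_integral.

(** * Lipschitz functions of pseudometrics *)

Section lipschitz.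
Context {R : realType} {T : eqType} (p : T -> T -> R).
Implicit Types (f g : T -> R) (C : R).

Definition lip C f := forall x y, `|f x - f y| <= C * p x y.

Lemma lipD C D f g : lip C f -> lip D g -> lip (C + D) (fun x => f x + g x).
Proof.
move=> lf lg x y; rewrite opprD addrACA mulrDl.
exact: le_trans (ler_normD _ _) (lerD (lf x y) (lg x y)).
Qed.

Lemma lipN C f : lip C f -> lip C (fun x => - f x).
Proof. by move=> lf x y; rewrite -opprD normrN. Qed.

Lemma lipZ C c f : lip C f -> lip (`|c| * C) (fun x => c * f x).
Proof. by move=> lf x y; rewrite -mulrBr normrM -mulrA ler_wpM2l. Qed.

Lemma lip_max C f g : lip C f -> lip C g -> lip C (fun x => Num.max (f x) (g x)).
Proof.
move=> lf lg x y; move: (lf x y) (lg x y); rewrite !ler_norml.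
by move=> /andP[? ?] /andP[? ?];
  case: (leP (f x) (g x)); case: (leP (f y) (g y)) => ? ?; lra.
Qed.

Lemma lip_min C f g : lip C f -> lip C g -> lip C (fun x => Num.min (f x) (g x)).
Proof.
move=> lf lg x y; move: (lf x y) (lg x y); rewrite !ler_norml.
by move=> /andP[? ?] /andP[? ?];
  case: (leP (f x) (g x)); case: (leP (f y) (g y)) => ? ?; lra.
Qed.

Lemma lip_sup (I : Type) (D : set I) (F : I -> T -> R) b C : D !=set0 ->
  (forall i, D i -> lip C (F i)) -> (forall i x, D i -> `|F i x| <= b) ->
  lip C (fun x => sup [set F i x | i in D]).
Proof.
move=> [i0 Di0] lF Fb x y.
have hub z : has_sup [set F i z | i in D].
  split; first by exists (F i0 z), i0.
  by exists b => _ [i Di <-]; exact: le_trans (ler_norm _) (Fb i z Di).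
have le1 : sup [set F i x | i in D] <= sup [set F i y | i in D] + C * p x y.
  apply: ge_sup; first by exists (F i0 x), i0.
  move=> _ [i Di <-]; have := lF i Di x y.
  rewrite ler_norml => /andP[_ h].
  have : F i y <= sup [set F i y | i in D].
    by apply: ub_le_sup; [case: (hub y)|exists i].
  lra.
have le2 : sup [set F i y | i in D] <= sup [set F i x | i in D] + C * p x y.
  apply: ge_sup; first by exists (F i0 y), i0.
  move=> _ [i Di <-]; have := lF i Di x y.
  rewrite ler_norml => /andP[h _].
  have : F i x <= sup [set F i x | i in D].
    by apply: ub_le_sup; [case: (hub x)|exists i].
  lra.
by rewrite ler_norml; apply/andP; split; lra.
Qed.

Hypothesis pp : is_pseudometric p.

Lemma le_lip C D f : C <= D -> lip C f -> lip D f.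
Proof.
move=> CD lf x y; apply: le_trans (lf x y) _; rewrite ler_wpM2r//.
by case: pp.
Qed.

Lemma lip_cst c : lip 0 (fun=> c).
Proof. by move=> x y; rewrite subrr normr0 mul0r. Qed.

Lemma lip_pseudometric z : lip 1 (fun x => p x z).
Proof.
move=> x y; have [_ _ pC ptri] := pp.
have := ptri x y z; have := ptri y x z; rewrite (pC y x) mul1r ler_norml.
by move=> ? ?; apply/andP; split; lra.
Qed.

(** The [p]-distance to the finite set [F], truncated at 1, which is also its value when [F] is
    empty. *)
Definition dist_seq (F : seq T) x := foldr (fun y a => Num.min (p x y) a) 1 F.

Lemma lip_dist_seq F : lip 1 (dist_seq F).
Proof.
elim: F => [|y F ih] /=; first exact: le_lip ler01 (lip_cst _).
exact: (lip_min (lip_pseudometric y) ih).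
Qed.

Lemma dist_seq_lt F x r : r <= 1 -> dist_seq F x < r ->
  exists2 y, y \in F & p x y < r.
Proof.
move=> r1; elim: F => [|y F ih] /=; first by rewrite ltNge r1.
rewrite gt_min => /orP[xy|/ih[z zF xz]].
  by exists y => //; rewrite mem_head.
by exists z => //; rewrite in_cons zF orbT.
Qed.

Lemma dist_seq_le F x y : y \in F -> dist_seq F x <= p x y.
Proof.
elim: F => //= z F ih; rewrite in_cons => /predU1P[->|yF].
  by rewrite ge_min lexx.
by rewrite ge_min ih ?orbT.
Qed.

Lemma dist_seq_cat F G x : dist_seq (F ++ G) x <= dist_seq F x /\
  dist_seq (F ++ G) x <= dist_seq G x.
Proof.
elim: F => [|y F [ih1 ih2]] /=.
  split => //; elim: G => //= z G ih; rewrite ge_min ih orbT//.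
by rewrite /= le_min !ge_min lexx/= ih1 ih2 !orbT.
Qed.

End lipschitz.

(** * Separation of compact sets and approximation of the total variation *)

Section continuous_pseudometric.
Context {R : realType} {X : ptopologicalType}.
Implicit Types (p q : X -> X -> R) (Q : set (X -> X -> R)).

Definition continuous_pseudometric p := is_pseudometric p /\
  forall x e, 0 < e -> nbhs x [set y | p x y < e].

Lemma lip_continuous p C f : continuous_pseudometric p -> 0 <= C ->
  lip p C f -> continuous f.
Proof.
move=> [pp cp] C0 lf x; apply/cvgrPdist_lt => e e0.
have C1 : 0 < C + 1 by lra.
have := cp x (e / (C + 1)) (divr_gt0 e0 C1).
apply: filterS => y /=; rewrite ltr_pdivlMr// => pe.
have p0 : 0 <= p x y by case: pp.
by apply: le_lt_trans (lf x y) _; nra.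
Qed.

Lemma lip_bounded_measurable p C f b : continuous_pseudometric p -> 0 <= C ->
  lip p C f -> (forall x, `|f x| <= b) -> bounded_measurable f.
Proof.
move=> cp C0 lf fb; split; last by exists b.
by apply: continuous_measurable; exact: lip_continuous lf.
Qed.

(** Such a family need not generate the topology of [X]. Besides [Pi], it will be the family of
    pseudometrics built from countably many continuous functions. *)
Definition directed_pseudometrics Q := [/\ Q !=set0,
  forall q, Q q -> continuous_pseudometric q &
  forall p q (e : R), Q p -> Q q -> 0 < e ->
    exists r (d : R), [/\ Q r, 0 < d
      & forall x y, r x y < d -> p x y < e /\ q x y < e]].

(** Otherwise the sets of pairs in [K] times [L] at [q]-distance less than [d] form a filter base,
    by directedness. It clusters at some [(a, b)], where the triangle inequality makes every [q a b]
    vanish. *)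
Lemma separate_compacts Q (K L : set X) : directed_pseudometrics Q ->
  compact K -> compact L ->
  (forall x y, K x -> L y -> exists2 q, Q q & 0 < q x y) ->
  exists q (d : R), [/\ Q q, 0 < d & forall x y, K x -> L y -> d <= q x y].
Proof.
move=> [[q0 Qq0] Qc Qd] cK cL KL; apply: contrapT => nsep.
pose D := [set i : (X -> X -> R) * R | Q i.1 /\ 0 < i.2].
pose B (i : (X -> X -> R) * R) :=
  [set z : X * X | [/\ K z.1, L z.2 & i.1 z.1 z.2 < i.2]].
have FF : ProperFilter (filter_from D B).
  apply: filter_from_proper.
    apply: filter_from_filter; first by exists (q0, 1).
    move=> [p d] [q e] [/= Qp d0] [/= Qq e0].
    have m0 : 0 < Num.min d e by rewrite lt_min d0.
    have [r [t [Qr t0 rt]]] := Qd p q _ Qp Qq m0.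
    exists (r, t) => // z [/= Kz Lz /rt[]]; rewrite !lt_min.
    by move=> /andP[? ?] /andP[? ?].
  move=> [q d] [/= Qq d0]; apply: contrapT => nB; apply: nsep.
  exists q, d; split => // x y Kx Ly; rewrite leNgt; apply/negP => lt.
  by apply: nB; exists (x, y).
have FKL : filter_from D B (K `*` L) by exists (q0, 1) => // z [].
have [[a b] [[/= Ka Lb] cl]] := compact_setX cK cL FF FKL.
have [q Qq qab] := KL a b Ka Lb.
have [[q_ge0 _ qC qtri] qc] := Qc q Qq.
have e0 : 0 < q a b / 3 by rewrite divr_gt0.
have Fq : filter_from D B (B (q, q a b / 3)) by exists (q, q a b / 3).
have nab : nbhs (a, b) ([set y | q a y < q a b / 3] `*` [set y | q b y < q a b / 3]).
  exists ([set y | q a y < q a b / 3], [set y | q b y < q a b / 3]) => //.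
  by split; exact: qc.
have [[x y] [[/= _ _ xy] [/= ax by_]]] := cl _ _ Fq nab.
have := qtri a x b; have := qtri x y b; rewrite (qC y b); lra.
Qed.

Lemma lip_separate q d (K L : set X) : is_pseudometric q -> 0 < d ->
  (forall x y, K x -> L y -> d <= q x y) ->
  exists g : X -> R, [/\ lip q (2 / d) g, forall x, `|g x| <= 1,
    forall x, K x -> g x = 1 & forall x, L x -> g x = -1].
Proof.
move=> qq d0 KL; have [q_ge0 q0 _ _] := qq.
(* The supremum of this family is 1 minus [2 / d] times the distance to [K], cut off below at -1.
   The index [None] keeps the family nonempty when [K] is empty. *)
pose F (i : option X) x : R := if i is Some y
  then Num.max (- 1) (1 + - (2 / d) * q x y) else - 1.
pose D := [set i : option X | if i is Some y then K y else True].
have c0 : 0 <= 2 / d by rewrite divr_ge0// ltW.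
have F1 i x : D i -> `|F i x| <= 1.
  case: i => [y|] _ /=; last by rewrite normrN1.
  have := mulr_ge0 c0 (q_ge0 x y).
  rewrite mulNr => ?; rewrite ler_norml.
  by case: (leP (-1) (1 - _)) => ?; apply/andP; split; lra.
have D0 : D !=set0 by exists None.
have hub x : has_ubound [set F i x | i in D].
  by exists 1 => _ [i Di <-]; exact: le_trans (ler_norm _) (F1 _ _ Di).
have g1 x : `|sup [set F i x | i in D]| <= 1.
  rewrite ler_norml; apply/andP; split.
    by apply: ub_le_sup => //; exists None.
  apply: ge_sup; first by exists (- 1), None.
  by move=> _ [i Di <-]; exact: le_trans (ler_norm _) (F1 _ _ Di).
exists (fun x => sup [set F i x | i in D]); split => //.
- apply: (lip_sup D0 _ F1) => -[y|] _ /=; last first.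
    exact: le_lip c0 (lip_cst q _).
  apply: lip_max; first exact: le_lip c0 (lip_cst q _).
  rewrite -[X in lip _ X]add0r; apply: lipD; first exact: lip_cst.
  have := lipZ (- (2 / d)) (lip_pseudometric qq y).
  by rewrite normrN ger0_norm// mulr1.
- move=> x Kx; apply/eqP; rewrite eq_le; apply/andP; split.
    by have := g1 x; rewrite ler_norml => /andP[].
  apply: ub_le_sup => //; exists (Some x) => //=.
  by rewrite q0 mulr0 addr0; apply/max_idPr; lra.
- move=> x Lx; apply/eqP; rewrite eq_le; apply/andP; split; last first.
    by apply: ub_le_sup => //; exists None.
  apply: ge_sup; first by exists (- 1), None.
  move=> _ [[y|] Di <-] //=; rewrite ge_max lexx/=.
  have := KL y x Di Lx; have [_ _ qC _] := qq; rewrite qC => dq.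
  have : 2 / d * d <= 2 / d * q x y by rewrite ler_wpM2l.
  by rewrite divfK ?gt_eqF//; lra.
Qed.

(** Compact subsets exhaust the two Hahn sets up to [e / 4] each, and a Lipschitz function takes the
    values 1 and -1 on them; the loss is twice the missing mass. Separation is required only for
    points that a Borel set tells apart: here the compact subset of the positive set does so. *)
Lemma tv_approx Q (nu : {charge set (borel X) -> \bar R}) e :
  directed_pseudometrics Q ->
  (forall (B : set (borel X)) x y, measurable B -> B x -> ~ B y ->
    exists2 q, Q q & 0 < q x y) ->
  radon nu -> 0 < e ->
  exists q C g, [/\ Q q, 0 <= C, lip q C g, forall x, `|g x| <= 1
    & tv nu setT - e <= charge_integral nu g].
Proof.
move=> dQ sQ rnu e0; have e4 : 0 < e / 4 by rewrite divr_gt0.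
have [K [cK mK KP tK]] := radon_tv rnu (measurable_hahn_pos nu) e4.
have [L [cL mL LN tL]] := radon_tv rnu (measurable_hahn_neg nu) e4.
have [|q [d [Qq d0 KL]]] := separate_compacts dQ cK cL.
  move=> x y Kx Ly; apply: (sQ K) => // Ky.
  have [_ _ _ PN0] := hahnP nu.
  suff : (set0 : set X) y by [].
  by rewrite -PN0; split; [exact: KP|exact: LN].
have [_ cQ _] := dQ; have [qq _] := cQ q Qq.
have [g [lg g1 gK gL]] := lip_separate qq d0 KL.
have c0 : 0 <= 2 / d by rewrite divr_ge0// ltW.
exists q, (2 / d), g; split => //.
have bg := lip_bounded_measurable (cQ _ Qq) c0 lg g1.
apply: le_trans (charge_integral_ge_tv nu bg mK mL g1 gK gL).
have ar (a b t : R) : a < e / 4 -> b < e / 4 -> t - e <= t - 2 * (a + b) by lra.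
exact: ar.
Qed.

End continuous_pseudometric.

(** * Uniform boundedness *)

Section uniform_bound.
Context {R : realType} {X : ptopologicalType}.
Implicit Types (nu : {charge set (borel X) -> \bar R}) (f g : X -> R).

Lemma le_charge_integral nu f a : bounded_measurable f -> 0 <= a ->
  (forall x, `|f x| <= a) -> `|charge_integral nu f| <= a * tv nu setT.
Proof.
move=> [mf _] a0 fa.
have := charge_integral_bound nu mf measurableT a0 a0 fa (fun x _ => fa x).
by rewrite setCT /tv measure0 /= mulr0 addr0.
Qed.

Lemma bounded_measurableD f g : bounded_measurable f -> bounded_measurable g ->
  bounded_measurable (fun x => f x + g x).
Proof.
move=> [mf [a fa]] [mg [b gb]]; split; first exact: measurable_funD.
by exists (a + b) => x; exact: le_trans (ler_normD _ _) (lerD (fa x) (gb x)).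
Qed.

Lemma bounded_measurableZ c f : bounded_measurable f ->
  bounded_measurable (fun x => c * f x).
Proof.
move=> [mf [a fa]]; split; first exact: measurable_funM.
by exists (`|c| * a) => x; rewrite normrM ler_wpM2l.
Qed.

Lemma uniform_approx_continuous f :
  (forall e, 0 < e -> exists2 g, continuous g & forall x, `|f x - g x| <= e) ->
  continuous f.
Proof.
move=> fg x; apply/cvgrPdist_lt => e e0.
have e3 : 0 < e / 3 by rewrite divr_gt0.
have [g cg gf] := fg _ e3.
have /cvgrPdist_lt/(_ _ e3) := cg x.
apply: filterS => y xy.
have := gf x; have := gf y; move: xy.
rewrite ltr_norml !ler_norml ltr_norml.
by move=> /andP[? ?] /andP[? ?] /andP[? ?]; apply/andP; split; lra.
Qed.

(** The radius [r n] is the sum of all later steps, so that the intervals of radius [r n] around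
    [u n] are nested; [l] is the supremum of their left ends. *)
Lemma geometric_limit (u : nat -> R) :
  (forall n, `|u n.+1 - u n| <= 3^-1 ^+ n) ->
  exists l, forall n, `|l - u n| <= 3 / 2 * 3^-1 ^+ n.
Proof.
move=> uS; pose r n : R := 3 / 2 * 3^-1 ^+ n.
have r0 n : 0 <= r n by rewrite mulr_ge0// exprn_ge0.
have rS n : r n - r n.+1 = 3^-1 ^+ n.
  by rewrite /r exprS; lra.
have aS : {homo (fun n => u n - r n) : m n / (m <= n)%N >-> m <= n}.
  apply: homo_leq => //; first exact: le_trans.
  by move=> n; have := uS n; rewrite ler_norml -(rS n) => /andP[? ?]; lra.
have bS : {homo (fun n => u n + r n) : m n / (m <= n)%N >-> n <= m}.
  apply: (homo_leq (r := fun x y : R => y <= x)) => //.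
    by move=> y x z xy yz; exact: le_trans yz xy.
  by move=> n; have := uS n; rewrite ler_norml -(rS n) => /andP[? ?]; lra.
have ab m n : u m - r m <= u n + r n.
  apply: le_trans (aS _ _ (leq_maxl m n)) (le_trans _ (bS _ _ (leq_maxr m n))).
  by have := r0 (maxn m n); lra.
exists (sup (range (fun n => u n - r n))) => n; rewrite -/(r n).
have h1 : u n - r n <= sup (range (fun n => u n - r n)).
  apply: ub_le_sup; last by exists n.
  by exists (u n + r n) => _ [m _ <-].
have h2 : sup (range (fun n => u n - r n)) <= u n + r n.
  by apply: ge_sup => [|_ [m _ <-]//]; exists (u 0%N - r 0%N), 0%N.
by rewrite ler_norml; apply/andP; split; lra.
Qed.

(* Sokal's proof of the uniform boundedness principle. *)
Lemma tv_bounded (Q : set (X -> X -> R))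
    (S : {charge set (borel X) -> \bar R} -> Prop) :
  directed_pseudometrics Q ->
  (forall (B : set (borel X)) x y, measurable B -> B x -> ~ B y ->
    exists2 q, Q q & 0 < q x y) ->
  (forall nu, S nu -> radon nu) ->
  (forall f, continuous f -> bounded_fun f ->
    exists M, forall nu, S nu -> `|charge_integral nu f| <= M) ->
  exists M, forall nu, S nu -> tv nu setT <= M.
Proof.
move=> dQ sQ Sr Sf; apply: contrapT => unb.
have /choice[s sP] (n : nat) : exists nu, S nu /\ 8 * n%:R * 3 ^+ n < tv nu setT.
  apply: contrapT => h; apply: unb; exists (8 * n%:R * 3 ^+ n) => nu Snu.
  by rewrite leNgt; apply/negP => lt; apply: h; exists nu.
have tv0 n : 0 < tv (s n) setT.
  by apply: le_lt_trans (sP n).2; rewrite !mulr_ge0// exprn_ge0.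
have /choice[g gP] n : exists g, [/\ continuous g, bounded_measurable g,
    forall x, `|g x| <= 1 & 7 / 8 * tv (s n) setT <= charge_integral (s n) g].
  have e0 : 0 < tv (s n) setT / 8 by rewrite divr_gt0.
  have [q [C [g [Qq C0 lg g1 tg]]]] := tv_approx dQ sQ (Sr _ (sP n).1) e0.
  have [_ /(_ q Qq) cq _] := dQ.
  exists g; split => //.
  - exact: lip_continuous lg.
  - exact: lip_bounded_measurable lg g1.
  - apply: le_trans tg.
    by have ar (t : R) : 7 / 8 * t <= t - t / 8 by lra.
(* The new term has weight [3^-1 ^+ n] and the sign of the integral of the partial sum against
   [s n]. As [g n] has positive integral, it never cancels what is already there. *)
pose c n (h : X -> R) : R :=
  if 0 <= charge_integral (s n) h then 3^-1 ^+ n else - 3^-1 ^+ n.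
pose fix x n : X -> R :=
  if n is m.+1 then fun t => x m t + c m (x m) * g m t else fun=> 0.
have p0 n : 0 <= 3^-1 ^+ n :> R by rewrite exprn_ge0.
have cn n h : `|c n h| = 3^-1 ^+ n.
  by rewrite /c; case: ifP => _; rewrite ?normrN ger0_norm.
have bx n : continuous (x n) /\ bounded_measurable (x n).
  elim: n => [|n [cx bx]] /=.
    split; first by move=> t; exact: cvg_cst.
    by split; [exact: measurable_cst|exists 0 => t; rewrite normr0].
  have [cg bg _ _] := gP n; split.
    move=> t; apply: cvgD; first exact: cx.
    by apply: cvgM; [exact: cvg_cst|exact: cg].
  by apply: bounded_measurableD => //; exact: bounded_measurableZ.
have xS n t : `|x n.+1 t - x n t| <= 3^-1 ^+ n.
  rewrite /= addrAC subrr add0r normrM cn ler_piMr//.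
  by have [_ _ + _] := gP n.
have /choice[f fx] t : exists l, forall n, `|l - x n t| <= 3 / 2 * 3^-1 ^+ n.
  by apply: geometric_limit => n; exact: xS.
have cf : continuous f.
  apply: uniform_approx_continuous => e e0.
  have [n ne] : exists n, 3 / 2 * 3^-1 ^+ n <= e.
    have [n en] : exists n : nat, 2 / e < n%:R.
      by exists (Num.trunc (2 / e)).+1; exact: truncnS_gt.
    exists n.
    have n3 : n%:R <= 3 ^+ n :> R by rewrite -natrX ler_nat ltnW// ltn_expl.
    rewrite exprVn ler_pdivrMr ?exprn_gt0//.
    have : 2 <= e * n%:R by move: en; rewrite ltr_pdivrMr// mulrC => /ltW.
    have : e * n%:R <= e * 3 ^+ n by rewrite ler_pM2l.
    lra.
  exists (x n); first by have [] := bx n.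
  by move=> t; exact: le_trans (fx t n) ne.
have fb t : `|f t| <= 3 / 2.
  by have := fx t 0%N; rewrite /= subr0 expr0 mulr1.
have bmf : bounded_measurable f.
  by split; [exact: continuous_measurable|exists (3 / 2)].
have [|M MP] := Sf f cf.
  exists (3 / 2); split; first exact: num_real.
  by move=> b bb t _; exact: le_trans (fb t) (ltW bb).
(* The integral of [x n.+1] is at least 7/8 of [3^-1 ^+ n] times the variation, and [f] differs from
   [x n.+1] by at most half of [3^-1 ^+ n]. There remain 3/8 of this product, and the variation
   exceeds [8 * n%:R * 3 ^+ n]. *)
have big n : 3 * n%:R <= `|charge_integral (s n) f|.
  have [cg bg g1 Ig] := gP n.
  have [cx bxn] := bx n; have [_ bxS] := bx n.+1.
  have I1 : charge_integral (s n) (x n.+1) =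
      charge_integral (s n) (x n) + c n (x n) * charge_integral (s n) (g n).
    rewrite /= charge_integralD ?charge_integralZ//.
    exact: bounded_measurableZ.
  have bd : bounded_measurable (fun t => f t + -1 * x n.+1 t).
    by apply: bounded_measurableD => //; exact: bounded_measurableZ.
  have d0 : 0 <= 3 / 2 * 3^-1 ^+ n.+1 :> R by rewrite mulr_ge0.
  have db t : `|f t + -1 * x n.+1 t| <= 3 / 2 * 3^-1 ^+ n.+1.
    by rewrite mulN1r; exact: fx.
  have := le_charge_integral (s n) bd d0 db.
  rewrite charge_integralD ?charge_integralZ//; last exact: bounded_measurableZ.
  rewrite I1 exprS.
  have := ltW (sP n).2.
  have := p0 n.
  have e3 : 3^-1 ^+ n * 3 ^+ n = 1 :> R by rewrite -exprMn mulVf ?expr1n.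
  move: e3 Ig; rewrite /c.
  move: (3^-1 ^+ n) (3 ^+ n) (charge_integral (s n) (x n)) (charge_integral (s n) (g n))
    (charge_integral (s n) f) (tv (s n) setT) (n%:R : R) => {}p P a b F T N.
  move=> pP hb p_ge0 hT.
  have h1 : 8 * N <= p * T.
    have -> : 8 * N = p * (8 * N * P).
      by rewrite mulrCA pP mulr1.
    by rewrite ler_wpM2l.
  have h2 : p * (7 / 8 * T) <= p * b by rewrite ler_wpM2l.
  case: ifP => a0 hF; move: hF; rewrite ler_norml => /andP[hF1 hF2].
    by apply: le_trans (ler_norm _); nra.
  move/negbT : a0; rewrite -ltNge => a0.
  by rewrite -normrN; apply: le_trans (ler_norm _); nra.
have [n nM] : exists n : nat, M < n%:R.
  by exists (Num.trunc M).+1; exact: truncnS_gt.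
have := le_trans (big n) (MP _ (sP n).1).
by have : 0 <= n%:R :> R by []; lra.
Qed.

End uniform_bound.

(** * Gliding hump *)

Section humps.
Context {R : realType} {X : ptopologicalType}.
Implicit Types (nu : {charge set (borel X) -> \bar R}) (f g : X -> R).

(** By induction on [F]: [S] is split according to the cell of width [e] containing the value at the
    new point, and a net is taken inside each of the finitely many pieces. Hence the net consists of
    members of [S], and inherits Lipschitz bounds. *)
Lemma finite_net (F : seq X) (e : R) (S : set (X -> R)) : 0 < e ->
  (forall f x, S f -> `|f x| <= 1) ->
  exists L : seq (X -> R), (forall h, h \in L -> S h) /\
    forall f, S f -> exists2 h, h \in L & forall y, y \in F -> `|f y - h y| <= e.
Proof.
move=> e0; elim: F S => [|y F ih] S S1.
  have [[f Sf]|S0] := pselect (S !=set0).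
    exists [:: f]; split; first by move=> h; rewrite inE => /eqP ->.
    by move=> g _; exists f; rewrite ?inE.
  by exists [::]; split => // f Sf; case: S0; exists f.
pose c f := Num.trunc ((f y + 1) / e).
have /choice[L LP] (j : nat) := ih [set f | S f /\ c f = j] (fun f x Sf => S1 f x Sf.1).
exists (flatten [seq L j | j <- iota 0 (Num.trunc (2 / e)).+1]); split.
  by move=> h /flatten_mapP[j _] /(LP j).1 [].
move=> f Sf; have [h hL fh] := (LP (c f)).2 f (conj Sf erefl).
have /andP[f1 f2] : - 1 <= f y <= 1 by rewrite -ler_norml; exact: S1.
exists h.
  apply/flatten_mapP; exists (c f) => //.
  rewrite mem_iota add0n /= ltnS; apply: le_truncn.
  by rewrite ler_pM2r ?invr_gt0//; lra.
move=> z; rewrite in_cons => /predU1P[->|zF]; last exact: fh.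
have [Sh chf] := (LP (c f)).1 h hL.
have /andP[h1 h2] : - 1 <= h y <= 1 by rewrite -ler_norml; exact: S1.
have af : 0 <= (f y + 1) / e by rewrite divr_ge0 ?(ltW e0)//; lra.
have ah : 0 <= (h y + 1) / e by rewrite divr_ge0 ?(ltW e0)//; lra.
have := truncn_itv af; have := truncn_itv ah.
rewrite -[Num.trunc ((h y + 1) / e)]/(c h) -[Num.trunc ((f y + 1) / e)]/(c f) chf.
rewrite -natr1 ler_pdivlMr// ltr_pdivrMr// ler_pdivlMr// ltr_pdivrMr// mulrDl mul1r.
by move=> /andP[? ?] /andP[? ?]; rewrite ler_norml; apply/andP; split; lra.
Qed.

Variables (p : X -> X -> R) (cp : continuous_pseudometric p).

Lemma open_dist_seq_lt F r : open [set x | dist_seq p F x < r].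
Proof.
have cd : continuous (dist_seq p F).
  exact: lip_continuous cp ler01 (lip_dist_seq cp.1 F).
have -> : [set x | dist_seq p F x < r] = dist_seq p F @^-1` [set t | t < r] by [].
by move/continuousP : cd; apply; exact: open_lt.
Qed.

Lemma measurable_dist_seq_lt F r :
  measurable ([set x | dist_seq p F x < r] : set (borel X)).
Proof. by apply: sub_sigma_algebra; exact: open_dist_seq_lt. Qed.

Lemma compact_dist_seq (K : set X) r : compact K -> 0 < r ->
  exists F : seq X, K `<=` [set x | dist_seq p F x < r].
Proof.
rewrite compact_cover => cK r0.
have oB y : open [set x | dist_seq p [:: y] x < Num.min r 1] by exact: open_dist_seq_lt.
have [|D _ KD] := cK X setT _ (fun y _ => oB y).
  move=> x Kx; exists x => //=; have [_ -> _ _] := cp.1.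
  by rewrite gt_min lt_min r0 ltr01.
exists (finmap.enum_fset D) => x /KD [y /= yD]; rewrite lt_min => /andP[xr x1].
apply: le_lt_trans xr; rewrite /= le_min dist_seq_le//=.
elim: (finmap.enum_fset D) => //= z F ih; by rewrite ge_min ih orbT.
Qed.

(** From here on neighbourhoods of finite sets, which are open, replace the compact sets given by
    the Radon property. *)
Lemma radon_dist_seq nu r e : radon nu -> 0 < r -> 0 < e ->
  exists F : seq X, tv nu (~` [set x | dist_seq p F x < r]) < e.
Proof.
move=> rnu r0 e0; have [K [cK mK _ tK]] := radon_tv rnu measurableT e0.
have [F KF] := compact_dist_seq cK r0.
exists F; apply: le_lt_trans tK; apply: le_tv.
- by apply: measurableC; exact: measurable_dist_seq_lt.
- by apply: measurableD.
- by rewrite setTD; exact: subsetC.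
Qed.

(** The supports are separated by a gap of width [r / 2], across which a function of Lipschitz
    constant [C] may vary by 4, the most that two functions bounded by 2 can differ. Neither the
    constant nor the bound grows, so gluing can be repeated indefinitely. *)
Lemma lip_glue F C r f g : 0 < r -> C * (r / 2) = 4 ->
  (forall x, `|f x| <= 2) -> (forall x, `|g x| <= 2) ->
  (forall x, r / 2 <= dist_seq p F x -> f x = 0) ->
  (forall x, dist_seq p F x < r -> g x = 0) ->
  lip p C f -> lip p C g ->
  lip p C (fun x => f x + g x) /\ forall x, `|f x + g x| <= 2.
Proof.
move=> r0 Cr f2 g2 f0 g0 lf lg; have r2 : r / 2 < r by lra.
have C0 : 0 < C.
  have r20 : 0 < r / 2 by rewrite divr_gt0.
  by rewrite -(pmulr_lgt0 _ r20) Cr.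
have pC : forall x y, p x y = p y x by case: cp.1.
have key x y : dist_seq p F x < r -> r <= dist_seq p F y ->
    `|f x + g x - (f y + g y)| <= C * p x y.
  move=> xr yr; rewrite (f0 y) ?add0r; last by lra.
  have [xr2|xr2] := leP (r / 2) (dist_seq p F x).
    by rewrite f0 ?add0r.
  rewrite g0// addr0.
  have : r / 2 <= p x y.
    have := lip_dist_seq cp.1 F x y; rewrite mul1r ler_norml => /andP[? _]; lra.
  rewrite -(ler_pM2l C0) Cr => h.
  apply: le_trans (ler_normB _ _) _.
  by have := f2 x; have := g2 y; lra.
split=> [x y|x]; last first.
  have [xr|xr] := ltP (dist_seq p F x) r; first by rewrite g0 ?addr0.
  by rewrite f0 ?add0r//; lra.
have [xr|xr] := ltP (dist_seq p F x) r; have [yr|yr] := ltP (dist_seq p F y) r.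
- by rewrite !g0 ?addr0.
- exact: key.
- by rewrite -opprB normrN pC; exact: key.
- by rewrite !(f0 x, f0 y) ?add0r//; lra.
Qed.

(* The hump: [v] is a soft thresholding of [f - h], hence vanishes near [F],
   and [w] cuts it off away from [F']. *)
Lemma exists_hump F F' r f h : 0 < r -> r <= 1 ->
  Lip1 p f -> Lip1 p h -> (forall x, `|f x| <= 1) -> (forall x, `|h x| <= 1) ->
  (forall y, y \in F -> `|f y - h y| <= r) ->
  exists v u : X -> R, [/\ lip p 4 v, lip p (8 / r) u,
    forall x, `|f x - h x - v x| <= 3 * r &
    [/\ forall x, `|v x| <= 2 /\ `|u x| <= 2,
    forall x, dist_seq p F x < r -> u x = 0,
    forall x, r / 2 <= dist_seq p F' x -> u x = 0 &
    forall x, dist_seq p F' x < r / 4 -> u x = v x]].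
Proof.
move=> r0 r1 lf lh f1 h1 fhF; have pp := cp.1.
have lf' : lip p 1 f by move=> x y; rewrite mul1r; exact: lf.
have lh' : lip p 1 h by move=> x y; rewrite mul1r; exact: lh.
pose d x := f x - h x; have ld : lip p 2 d by exact: lipD lf' (lipN lh').
(* The difference [d] is at most [r] on [F] and 2-Lipschitz, hence at most [3 * r] within distance
   [r] of [F]: the threshold [3 * r] kills it there. *)
pose v x := Num.max (d x + - (3 * r)) 0 + Num.min (d x + 3 * r) 0.
(* This is 2 up to distance [r / 4] from [F'] and 0 from distance [r / 2] on. The hump is [v]
   clipped to the interval from [- w] to [w], which changes nothing where [w] is 2. *)
pose w x := Num.max 0 (Num.min 2 (4 + - (8 / r) * dist_seq p F' x)).
have le8 C : C <= 8 -> C <= 8 / r.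
  by move=> C8; rewrite ler_pdivlMr//; nra.
have r8 : 0 <= 8 / r by rewrite divr_ge0// ltW.
have d2 x : `|d x| <= 2.
  by apply: le_trans (ler_normB _ _) _; have := f1 x; have := h1 x; lra.
have lv : lip p 4 v.
  have -> : 4 = 2 + 2 :> R by lra.
  apply: lipD; [apply: lip_max|apply: lip_min].
  - by rewrite -[X in lip _ X]addr0; apply: lipD => //; exact: lip_cst.
  - exact: le_lip (lip_cst _ _).
  - by rewrite -[X in lip _ X]addr0; apply: lipD => //; exact: lip_cst.
  - exact: le_lip (lip_cst _ _).
have lw : lip p (8 / r) w.
  apply: lip_max; first exact: le_lip (lip_cst _ _).
  apply: lip_min; first exact: le_lip (lip_cst _ _).
  rewrite -[X in lip _ X]add0r; apply: lipD; first exact: lip_cst.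
  have := lipZ (- (8 / r)) (lip_dist_seq pp F').
  by rewrite normrN ger0_norm// mulr1.
have w0 x : 0 <= w x by rewrite /w le_max lexx.
have w2 x : w x <= 2 by rewrite /w ge_max ge_min lexx andbT.
have v2 x : `|v x| <= 2.
  have := d2 x; rewrite /v !ler_norml => /andP[? ?].
  by case: (leP (d x + - (3 * r)) 0) => ?; case: (leP (d x + 3 * r) 0) => ?;
    apply/andP; split; lra.
exists v, (fun x => Num.max (- w x) (Num.min (w x) (v x))); split => //.
- apply: lip_max; first exact: lipN.
  by apply: lip_min => //; apply: le_lip lv; [exact: pp|apply: le8; lra].
- move=> x; rewrite -/(d x) /v ler_norml.
  by case: (leP (d x + - (3 * r)) 0) => ?; case: (leP (d x + 3 * r) 0) => ?;
    apply/andP; split; lra.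
split.
- move=> x; split=> //; have := w0 x; have := w2 x; rewrite ler_norml => ? ?.
  by case: (leP (w x) (v x)) => ?;
    [case: (leP (- w x) (w x)) => ?|case: (leP (- w x) (v x)) => ?];
    apply/andP; split; lra.
- move=> x /(dist_seq_lt r1)[y yF xy].
  have /andP[? ?] : - (3 * r) <= d x <= 3 * r.
    rewrite -ler_norml; have := ld x y; have := fhF y yF; rewrite -/(d y).
    by rewrite !ler_norml => /andP[? ?] /andP[? ?]; apply/andP; split; lra.
  have -> : v x = 0.
    rewrite /v; case: (leP (d x + - (3 * r)) 0) => ?; last by lra.
    by case: (leP (d x + 3 * r) 0) => ?; lra.
  have := w0 x => ?; case: (leP (w x) 0) => ?.
    by have -> : w x = 0 by [lra]; rewrite oppr0 maxxx.
  by apply/max_idPr; lra.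
- move=> x rx; have -> : w x = 0.
    have : 8 / r * (r / 2) <= 8 / r * dist_seq p F' x by rewrite ler_wpM2l.
    have -> : 8 / r * (r / 2) = 4 by field; rewrite gt_eqF.
    move=> ?; apply/max_idPl; rewrite ge_min; apply/orP; right; lra.
  by rewrite oppr0; apply/max_idPl; rewrite ge_min lexx.
- move=> x rx; have -> : w x = 2.
    have : 8 / r * dist_seq p F' x <= 8 / r * (r / 4) by rewrite ler_wpM2l// ltW.
    have -> : 8 / r * (r / 4) = 2 by field; rewrite gt_eqF.
    move=> ?; rewrite /w (min_idPl _); last lra.
    by apply/max_idPr.
  have := v2 x; rewrite ler_norml => /andP[? ?].
  by rewrite (min_idPr _)//; apply/max_idPr.
Qed.

End humps.

(** * From pointwise to uniform convergence on bounded Lipschitz functions *)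

Section uniform_convergence.
Context {R : realType} {X : ptopologicalType}.
Variables (p : X -> X -> R) (s : nat -> {charge set (borel X) -> \bar R}) (M : R).
Hypotheses (cp : continuous_pseudometric p) (rs : forall k, radon (s k))
  (sM : forall k, tv (s k) setT <= M)
  (s0 : forall f C b, 0 <= C -> lip p C f -> (forall x, `|f x| <= b) ->
    forall e, 0 < e ->
    exists N, forall k, (N <= k)%N -> `|charge_integral (s k) f| <= e).

Lemma charge_integral_eq_on (nu : {charge set (borel X) -> \bar R})
    (f g : X -> R) (b e : R) F r : bounded_measurable f ->
  bounded_measurable g -> 0 <= b -> (forall x, `|f x - g x| <= b) ->
  (forall x, dist_seq p F x < r -> f x = g x) ->
  tv nu (~` [set x | dist_seq p F x < r]) <= e ->
  `|charge_integral nu f - charge_integral nu g| <= b * e.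
Proof.
move=> bf bg b0 fgb fg te.
have bd : bounded_measurable (fun x => f x + -1 * g x).
  by apply: bounded_measurableD => //; exact: bounded_measurableZ.
have := charge_integral_bound nu bd.1 (measurable_dist_seq_lt cp F r) (lexx 0) b0.
rewrite charge_integralD ?charge_integralZ//; last exact: bounded_measurableZ.
rewrite mul0r add0r mulN1r => h; apply: le_trans (h _ _) _.
- by move=> x; rewrite mulN1r.
- by move=> x xr; rewrite mulN1r fg ?subrr ?normr0.
- by rewrite ler_wpM2l.
Qed.

Lemma eventually_small (L : seq (X -> R)) e : 0 < e ->
  (forall h, h \in L -> Lip1 p h /\ forall x, `|h x| <= 1) ->
  exists N, forall k h, (N <= k)%N -> h \in L -> `|charge_integral (s k) h| <= e.
Proof.
move=> e0; elim: L => [|h L ih] hL; first by exists 0%N.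
have [|N NP] := ih; first by move=> g gL; apply: hL; rewrite in_cons gL orbT.
have [lh h1] := hL h (mem_head _ _).
have lh' : lip p 1 h by move=> x y; rewrite mul1r; exact: lh.
have [N' NP'] := s0 ler01 lh' h1 e0.
exists (maxn N N') => k g; rewrite geq_max => /andP[kN kN'].
by rewrite in_cons => /predU1P[->|gL]; [exact: NP'|exact: NP].
Qed.

(** Here [bad] denies uniform convergence, and [rM] makes [r] so small that soft thresholding costs
    at most [eps / 8] in every integral. *)
Variables (r eps : R).
Hypotheses (r0 : 0 < r) (r1 : r <= 1) (eps0 : 0 < eps) (rM : 3 * r * M <= eps / 8)
  (bad : forall N, exists k f, [/\ (N <= k)%N, Lip1 p f, forall x, `|f x| <= 1
    & eps < charge_integral (s k) f]).

Let r2_lt : r / 2 < r. Proof. by rewrite ltr_pdivrMr// ltr_pMr// ltr1n. Qed.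

Let r4_lt : r / 4 < r. Proof. by rewrite ltr_pdivrMr// ltr_pMr// ltr1n. Qed.

Let lip_r8 : 0 <= 8 / r. Proof. by rewrite divr_ge0// ltW. Qed.

(** Take a bad [f] for a late [k] and an [h] of a finite net that is close to [f] on [F]; as the net
    is finite, the integral of [h] is already at most [eps / 8]. Thresholding [f - h] and cutting it
    off away from [F'] cost [eps / 8] each, which leaves more than [eps / 2]. *)
Lemma hump_step F N : exists k F' u, [/\ (N <= k)%N, lip p (8 / r) u,
   forall x, `|u x| <= 2 &
   [/\ forall x, dist_seq p F x < r -> u x = 0,
   forall x, r / 2 <= dist_seq p F' x -> u x = 0,
   forall x, dist_seq p F' x <= dist_seq p F x,
   tv (s k) (~` [set x | dist_seq p F' x < r / 4]) <= eps / 32 &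
   eps / 2 <= charge_integral (s k) u]].
Proof.
have [|L [LS LP]] := @finite_net R X F r [set f | Lip1 p f /\ forall x, `|f x| <= 1] r0.
  by move=> f x [].
have [|N' NP] := @eventually_small L (eps / 8) _ LS; first by rewrite divr_gt0.
have [k [f [kN lf f1 If]]] := bad (maxn N N').
have [h hL fh] := LP f (conj lf f1).
have [lh h1] := LS h hL.
have r4 : 0 < r / 4 by rewrite divr_gt0.
have e32 : 0 < eps / 32 by rewrite divr_gt0.
have [Fk tFk] := radon_dist_seq cp (rs k) r4 e32.
have [v [u [lv lu fhv [vu2 u0 u0' uv]]]] :=
  exists_hump cp (F ++ Fk) r0 r1 lf lh f1 h1 fh.
have bm g : Lip1 p g -> (forall x, `|g x| <= 1) -> bounded_measurable g.
  move=> lg g1; apply: lip_bounded_measurable cp ler01 _ g1.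
  by move=> x y; rewrite mul1r; exact: lg.
have bf := bm f lf f1; have bh := bm h lh h1.
have bv : bounded_measurable v.
  exact: lip_bounded_measurable cp _ lv (fun x => (vu2 x).1).
have bu : bounded_measurable u.
  exact: lip_bounded_measurable cp _ lu (fun x => (vu2 x).2).
have tF' : tv (s k) (~` [set x | dist_seq p (F ++ Fk) x < r / 4]) <= eps / 32.
  apply: le_trans (ltW tFk); apply: le_tv.
  - by apply: measurableC; exact: measurable_dist_seq_lt.
  - by apply: measurableC; exact: measurable_dist_seq_lt.
  - apply: subsetC => x /=; apply: le_lt_trans.
    by have [] := dist_seq_cat p F Fk x.
exists k, (F ++ Fk), u; split => //.
- by apply: leq_trans kN; exact: leq_maxl.
- by move=> x; have [] := vu2 x.
split => //.
  by move=> x; have [] := dist_seq_cat p F Fk x.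
have Ih : `|charge_integral (s k) h| <= eps / 8.
  by apply: NP => //; apply: leq_trans kN; exact: leq_maxr.
have Iuv : `|charge_integral (s k) u - charge_integral (s k) v| <= 4 * (eps / 32).
  apply: charge_integral_eq_on (uv) tF' => // x.
  apply: le_trans (ler_normB _ _) _; have [? ?] := vu2 x; lra.
have bd1 : bounded_measurable (fun x => f x + -1 * h x).
  by apply: bounded_measurableD => //; exact: bounded_measurableZ.
have bd : bounded_measurable (fun x => (f x + -1 * h x) + -1 * v x).
  by apply: bounded_measurableD => //; exact: bounded_measurableZ.
have r3 : 0 <= 3 * r by rewrite mulr_ge0// ltW.
have db x : `|(f x + -1 * h x) + -1 * v x| <= 3 * r by rewrite !mulN1r; exact: fhv.
have := le_charge_integral (s k) bd r3 db.
rewrite charge_integralD//; last exact: bounded_measurableZ.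
rewrite charge_integralD//; last exact: bounded_measurableZ.
rewrite !charge_integralZ//.
have : 3 * r * tv (s k) setT <= eps / 8.
  by apply: le_trans rM; rewrite ler_wpM2l.
move: If Ih Iuv.
move: (charge_integral (s k) f) (charge_integral (s k) h) (charge_integral (s k) u)
  (charge_integral (s k) v) (3 * r * tv (s k) setT) => a b c d t ?.
rewrite !ler_norml => /andP[? ?] /andP[? ?] ? /andP[? ?]; lra.
Qed.

(* A state [(F, G, k)] of the construction: [G] is the sum of the humps chosen so
   far and is supported near the finite set [F]; the last hump was chosen for
   the charge [s k]. *)
Definition hump_inv (z : seq X * (X -> R) * nat) := [/\ lip p (8 / r) z.1.2,
  forall x, `|z.1.2 x| <= 2 & forall x, r / 2 <= dist_seq p z.1.1 x -> z.1.2 x = 0].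

Definition hump_next (z z' : seq X * (X -> R) * nat) := [/\ (z.2 < z'.2)%N,
  forall x, dist_seq p z.1.1 x < r -> z'.1.2 x = z.1.2 x,
  forall x, dist_seq p z'.1.1 x <= dist_seq p z.1.1 x,
  tv (s z'.2) (~` [set x | dist_seq p z'.1.1 x < r / 4]) <= eps / 32 &
  3 * eps / 8 <= charge_integral (s z'.2) z'.1.2].

(** The sum [G] so far is one fixed Lipschitz function, so late charges integrate it to at most
    [eps / 8]. A new hump worth [eps / 2] then brings the sum to at least [3 * eps / 8]. *)
Lemma hump_nextP z : hump_inv z -> exists z', hump_inv z' /\ hump_next z z'.
Proof.
move: z => [[F G] k] [/= lG G2 G0].
have [|N NP] := s0 lip_r8 lG G2 (e := eps / 8); first by rewrite divr_gt0.
have [k' [F' [u [kN lu u2 [u0 u0' FF' tF' Iu]]]]] := hump_step F (maxn N k.+1).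
have Cr : 8 / r * (r / 2) = 4 by field; rewrite gt_eqF.
have [lGu Gu2] := lip_glue cp r0 Cr G2 u2 G0 u0 lG lu.
have bG := lip_bounded_measurable cp lip_r8 lG G2.
have bu := lip_bounded_measurable cp lip_r8 lu u2.
exists (F', (fun x => G x + u x), k'); split; split => //=.
- by move=> x rx; rewrite u0'// G0 ?addr0//; exact: le_trans (FF' x).
- by apply: leq_trans kN; exact: leq_maxr.
- by move=> x rx; rewrite u0// addr0.
- rewrite charge_integralD//.
  have := NP k' (leq_trans (leq_maxl _ _) kN); rewrite ler_norml => /andP[+ _].
  by move: Iu; move: (charge_integral _ u) (charge_integral _ G) => a b ? ?; lra.
Qed.

(** The limit [f] of the sums is Lipschitz and agrees with [G n] near [F n], which carries almost
    all of the charge [s (k n)]. Its integral against that charge is therefore at least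
    [3 * eps / 8 - eps / 8], although it should tend to 0. *)
Lemma gliding_hump_absurd : False.
Proof.
have /choice[nx nxP] z : exists z', hump_inv z -> hump_inv z' /\ hump_next z z'.
  have [iz|nz] := pselect (hump_inv z); last by exists z => /nz.
  by have [z' ?] := hump_nextP iz; exists z'.
(* For the empty set the truncated distance is 1, hence not below [r]: the initial state puts no
   constraint on the first hump. *)
pose z n := iter n nx ([::], fun=> 0, 0%N).
have zi n : hump_inv (z n).
  elim: n => [|n /nxP[]//]; split => //=.
  - by apply: (le_lip cp.1 lip_r8); exact: lip_cst.
  - by move=> x; rewrite normr0.
have zS n : hump_next (z n) (z n.+1) by exact: (nxP _ (zi n)).2.
pose F n := (z n).1.1; pose G n := (z n).1.2; pose k n := (z n).2.
have kn n : (n <= k n)%N.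
  by elim: n => // n ih; have [+ _ _ _ _] := zS n; exact: leq_ltn_trans.
have Fm m n x : (m <= n)%N -> dist_seq p (F n) x <= dist_seq p (F m) x.
  move=> mn; rewrite -(subnK mn); elim: (n - m)%N => // i ih.
  by rewrite addSn; apply: le_trans ih; have [_ _ + _ _] := zS (i + m)%N; exact.
have Gm m n x : (m <= n)%N -> dist_seq p (F m) x < r -> G n x = G m x.
  move=> mn xr; rewrite -(subnK mn); elim: (n - m)%N => // i ih.
  rewrite addSn -ih; have [_ + _ _ _] := zS (i + m)%N; apply.
  by apply: le_lt_trans xr; apply: Fm; rewrite leq_addl.
(* Once [x] is within [r] of some [F m], later humps vanish at [x]. If this never happens, every
   [G n] vanishes at [x]. *)
have /choice[f fP] x : exists l, exists m, forall n, (m <= n)%N -> G n x = l.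
  have [[m xm]|nx'] := pselect (exists m, dist_seq p (F m) x < r).
    by exists (G m x), m => n mn; exact: Gm.
  exists 0, 0%N => n _; have [_ _] := zi n; apply.
  rewrite leNgt; apply/negP => lt; apply: nx'; exists n.
  exact: lt_trans lt r2_lt.
have fG n x : dist_seq p (F n) x < r -> f x = G n x.
  move=> xr; have [m mP] := fP x.
  by rewrite -(mP _ (leq_maxl m n)); apply: Gm => //; exact: leq_maxr.
have lf : lip p (8 / r) f.
  move=> x y; have [m mP] := fP x; have [n nP] := fP y.
  rewrite -(mP _ (leq_maxl m n)) -(nP _ (leq_maxr m n)).
  by have [+ _ _] := zi (maxn m n); exact.
have f2 x : `|f x| <= 2.
  by have [m mP] := fP x; rewrite -(mP _ (leqnn m)); have [_ + _] := zi m; exact.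
have e8 : 0 < eps / 8 by rewrite divr_gt0.
have [N NP] := s0 lip_r8 lf f2 e8.
have [_ _ _ tN IN] := zS N; have [lG G2 _] := zi N.+1.
have := NP (k N.+1) (leq_trans (leqnSn N) (kn _)).
have bf := lip_bounded_measurable cp lip_r8 lf f2.
have bG := lip_bounded_measurable cp lip_r8 lG G2.
have := @charge_integral_eq_on (s (k N.+1)) f (G N.+1) 4 (eps / 32) (F N.+1) (r / 4)
  bf bG (ler0n _ _) _ _ tN.
move=> h h'.
have {h} : `|charge_integral (s (k N.+1)) f - charge_integral (s (k N.+1)) (G N.+1)|
    <= 4 * (eps / 32).
  apply: h => x; last by move=> xr; apply: fG; exact: lt_trans xr r4_lt.
  apply: le_trans (ler_normB _ _) _.
  by have := f2 x; have := G2 x; rewrite -/(G _ x); lra.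
move: h' IN; rewrite -/(G N.+1) -/(k N.+1).
move: (charge_integral (s (k N.+1)) f) (charge_integral (s (k N.+1)) (G N.+1)) => a b.
rewrite !ler_norml => /andP[? ?] ? /andP[? ?]; lra.
Qed.

End uniform_convergence.

(** * Determining families *)

Section lip_uniform.
Context {R : realType} {X : ptopologicalType}.

Lemma lip_uniform_convergence (p : X -> X -> R)
    (s : nat -> {charge set (borel X) -> \bar R}) (M : R) :
  continuous_pseudometric p -> (forall k, radon (s k)) ->
  (forall k, tv (s k) setT <= M) ->
  (forall f C b, 0 <= C -> lip p C f -> (forall x, `|f x| <= b) ->
    forall e, 0 < e ->
    exists N, forall k, (N <= k)%N -> `|charge_integral (s k) f| <= e) ->
  forall e, 0 < e -> exists N, forall k f, (N <= k)%N -> Lip1 p f ->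
    (forall x, `|f x| <= 1) -> charge_integral (s k) f <= e.
Proof.
move=> cp rs sM s0 e e0; apply: contrapT => nN.
have M0 : 0 <= M by exact: le_trans (tv_ge0 _ _) (sM 0%N).
have c0 : 0 < 24 * (M + 1) by lra.
(* The factor 24 turns [3 * r * M] into at most [e / 8], and [M + 1] is positive even if [M] is
   0. *)
pose r := Num.min 1 (e / (24 * (M + 1))).
have r0 : 0 < r by rewrite lt_min ltr01 divr_gt0.
have r1 : r <= 1 by rewrite ge_min lexx.
have rM : 3 * r * M <= e / 8.
  have : r <= e / (24 * (M + 1)) by rewrite ge_min lexx orbT.
  by rewrite ler_pdivlMr// => ?; nra.
apply: (gliding_hump_absurd cp rs sM s0 r0 r1 e0 rM) => N; apply: contrapT => nk.
apply: nN; exists N => k f Nk lf f1; rewrite leNgt; apply/negP => lt.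
by apply: nk; exists k, f.
Qed.

End lip_uniform.

Section determining.
Context {R : realType} {X : ptopologicalType}.
Implicit Types (d : X -> X -> R) (nu : {charge set (borel X) -> \bar R}).

Definition separable_pseudometric d :=
  exists u : nat -> X, forall x e, 0 < e -> exists n, d x (u n) < e.

(** Rational heights and indexed centres make this family countable. The value -1 of the empty
    maximum lies below every function bounded by 1. *)
Definition max_cones d (u : nat -> X) (L : seq (nat * rat)) (x : X) : R :=
  foldr (fun c a => Num.max (ratr c.2 - d x (u c.1)) a) (- 1) L.

Lemma lip_max_cones d u L : is_pseudometric d -> lip d 1 (max_cones d u L).
Proof.
move=> dd; elim: L => [|c L ih] /=; first exact: le_lip ler01 (lip_cst d (- 1)).
apply: lip_max => //; rewrite -[X in lip _ X]add0r.
by apply: lipD; [exact: lip_cst|apply: lipN; exact: lip_pseudometric].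
Qed.

Lemma max_cones_bounded d u L : is_pseudometric d ->
  exists b, forall x, `|max_cones d u L x| <= b.
Proof.
move=> [d0 _ _ _].
have [b b1] : exists b, forall x, -1 <= max_cones d u L x <= b.
  elim: L => [|c L [b ih]] /=; first by exists (- 1) => x; rewrite lexx.
  exists (Num.max (ratr c.2) b) => x; have /andP[h1 h2] := ih x.
  rewrite le_max h1 orbT /= ge_max !le_max h2 orbT andbT.
  by rewrite lerBlDr lerDl d0.
exists (Num.max 1 b) => x; have /andP[h1 h2] := b1 x.
rewrite ler_norml le_max h2 orbT andbT.
by apply: le_trans h1; rewrite lerN2 le_max lexx.
Qed.

(** For each point of a finite set [F] near which [nu] is almost carried, choose a cone with nearby
    centre and height just below [f] there; it stays below [f]. Their maximum [h] differs from [f]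
    by at most [5 * e] near [F] and by at most 2 elsewhere, where [nu] has variation less than
    [e]. *)
Lemma determining_lip1 d (u : nat -> X) nu f : continuous_pseudometric d ->
  (forall x e, 0 < e -> exists n, d x (u n) < e) -> radon nu ->
  (forall L, charge_integral nu (max_cones d u L) = 0) ->
  lip d 1 f -> (forall x, `|f x| <= 1) -> charge_integral nu f = 0.
Proof.
move=> cd du rnu nu0 lf f1; have [dd _] := cd.
have [d_ge0 _ dC dtri] := dd.
suff key e : 0 < e -> e <= 1 ->
    `|charge_integral nu f| <= (5 * tv nu setT + 2) * e.
  apply/eqP; rewrite -normr_le0; apply/ler_addgt0Pl => e e0; rewrite addr0.
  set c := 5 * tv nu setT + 2 in key.
  have c0 : 0 < c by have := tv_ge0 nu setT; rewrite /c; move: (tv nu setT) => t ?; lra.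
  have m0 : 0 < Num.min 1 (e / c) by rewrite lt_min ltr01 divr_gt0.
  apply: le_trans (key _ m0 _) _; first by rewrite ge_min lexx.
  rewrite mulrC -ler_pdivlMr//; by rewrite ge_min lexx orbT.
move=> e0 e1.
have [F tF] := radon_dist_seq cd rnu e0 e0.
have /choice[c cP] (y : X) : exists c : nat * rat,
    d y (u c.1) < e /\ f (u c.1) - e < ratr c.2 < f (u c.1).
  have [n yn] := du y e e0.
  have [|q] := @rat_in_itvoo R (f (u n) - e) (f (u n)); first by lra.
  by rewrite in_itv /= => qP; exists (n, q).
pose h := max_cones d u [seq c y | y <- F].
have hf x : -1 <= h x <= f x.
  rewrite /h; elim: F {tF h} => [|y F /andP[ih1 ih2]] /=.
    by rewrite lexx; have := f1 x; rewrite ler_norml => /andP[].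
  rewrite le_max ih1 orbT ge_max ih2 andbT /=.
  have [_ /andP[_ qf]] := cP y.
  have := lf x (u (c y).1); rewrite mul1r ler_norml => /andP[? _]; lra.
have fh2 x : `|f x - h x| <= 2.
  have /andP[? ?] := hf x; have := f1 x; rewrite !ler_norml => /andP[? ?].
  by apply/andP; split; lra.
have bf := lip_bounded_measurable cd ler01 lf f1.
have [b hb] := max_cones_bounded u [seq c y | y <- F] dd.
have bh := lip_bounded_measurable cd ler01 (lip_max_cones u _ dd) hb.
have bd : bounded_measurable (fun x => f x + -1 * h x).
  by apply: bounded_measurableD => //; exact: bounded_measurableZ.
have e5 : 0 <= 5 * e by rewrite mulr_ge0// ltW.
have := charge_integral_bound nu bd.1 (measurable_dist_seq_lt cd F e) e5 (ler0n _ 2).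
rewrite charge_integralD ?charge_integralZ//; last exact: bounded_measurableZ.
rewrite nu0 mulr0 addr0 => H.
have {H} := H _ _; set T1 := tv nu setT; set T2 := tv nu _.
have ar (I t s : R) : s < e -> I <= 5 * e * t + 2 * s -> I <= (5 * t + 2) * e by lra.
move=> H; apply: (ar _ _ _ tF); apply: H => x; first by rewrite mulN1r.
move=> /(dist_seq_lt e1)[y yF xy]; rewrite mulN1r.
have /andP[? ?] := hf x; have [yu /andP[q1 q2]] := cP y.
have hx : ratr (c y).2 - d x (u (c y).1) <= h x.
  rewrite /h; move: yF; clear; elim: F => //= z F ih.
  rewrite in_cons => /predU1P[->|yF]; first by rewrite le_max lexx.
  by rewrite le_max ih ?orbT.
have := dtri x y (u (c y).1).
have := lf x (u (c y).1); rewrite mul1r ler_norml => /andP[? ?] ?.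
by rewrite ler_norml; apply/andP; split; lra.
Qed.

Lemma determining_lip d (u : nat -> X) nu C b f : continuous_pseudometric d ->
  (forall x e, 0 < e -> exists n, d x (u n) < e) -> radon nu ->
  (forall L, charge_integral nu (max_cones d u L) = 0) ->
  0 <= C -> lip d C f -> (forall x, `|f x| <= b) -> charge_integral nu f = 0.
Proof.
move=> cd du rnu nu0 C0 lf fb; have [dd _] := cd.
have b0 : 0 <= b by exact: le_trans (normr_ge0 _) (fb point).
pose c := C + b + 1; have c0 : 0 < c by rewrite /c; lra.
have ci : 0 <= c^-1 by rewrite invr_ge0 ltW.
have bf := lip_bounded_measurable cd C0 lf fb.
have : charge_integral nu (fun x => c^-1 * f x) = 0.
  apply: (determining_lip1 cd du rnu nu0).
    have := lipZ c^-1 lf; rewrite ger0_norm//; apply: le_lip => //.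
    by rewrite mulrC ler_pdivrMr// /c; lra.
  move=> x; rewrite normrM ger0_norm// mulrC ler_pdivrMr//.
  by apply: le_trans (fb x) _; rewrite /c; lra.
rewrite charge_integralZ// => /eqP; rewrite mulf_eq0 invr_eq0 gt_eqF//=.
by move/eqP.
Qed.

End determining.

Section separability.
Context {R : realType} {X : ptopologicalType}.

Lemma countable_sequence (T : Type) (A : set T) (t0 : T) : countable A ->
  exists u : nat -> T, (forall n, A (u n) \/ u n = t0) /\
    forall x, A x -> exists n, u n = x.
Proof.
move=> /countable_injP[f fI].
have /choice[u uP] n : exists x, (A x /\ f x = n) \/
    (x = t0 /\ ~ exists y, A y /\ f y = n).
  have [[x ?]|?] := pselect (exists y, A y /\ f y = n); first by exists x; left.
  by exists t0; right.
exists u; split=> [n|x Ax]; first by case: (uP n) => [[]|[]]; [left|right].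
exists (f x); case: (uP (f x)) => [[Au fu]|[_ []]]; last by exists x.
by apply: fI fu; exact: mem_set.
Qed.

Lemma open_pseudometric_ball (p : X -> X -> R) x e : continuous_pseudometric p ->
  open [set y | p x y < e].
Proof.
move=> [[_ _ pC ptri] cp]; rewrite openE => y /= xy; rewrite /interior /=.
have ey : 0 < e - p x y by rewrite subr_gt0.
apply: filterS (cp y _ ey) => z /= yz.
by apply: le_lt_trans (ptri x y z) _; rewrite -ltrBrDl.
Qed.

Variables (phi : nat -> X -> R) (cphi : forall n, continuous (phi n)).

Fixpoint max_diff (N : nat) (x y : X) : R :=
  if N is n.+1 then Num.max (max_diff n x y) `|phi n x - phi n y| else 0.

Lemma max_diff_continuous N : continuous_pseudometric (max_diff N).
Proof.
elim: N => [|n [[p0 pxx pC ptri] cp]].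
  split; first by split => //= *; rewrite addr0.
  by move=> x e e0; apply: filterS filterT => y _ /=.
split; first split => /=.
- by move=> x y; rewrite le_max p0.
- by move=> x; rewrite pxx subrr normr0 maxxx.
- by move=> x y; rewrite pC distrC.
- move=> x y z; rewrite ge_max; apply/andP; split.
    by apply: le_trans (ptri x y z) _; apply: lerD; rewrite le_max lexx.
  apply: le_trans (ler_distD (phi n y) _ _) _.
  by apply: lerD; rewrite le_max lexx orbT.
- move=> x e e0 /=.
  have /cvgrPdist_lt/(_ e e0) h := @cphi n x.
  apply: filterS2 (cp x e e0) h => y /= h1 h2.
  by rewrite gt_max h1.
Qed.

Lemma le_max_diff m n x y : (m <= n)%N -> max_diff m x y <= max_diff n x y.
Proof.
move=> mn; rewrite -(subnK mn); elim: (n - m)%N => // i ih.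
by rewrite addSn /= le_max ih.
Qed.

Lemma max_diff_directed : directed_pseudometrics (range max_diff).
Proof.
split; first by exists (max_diff 0), 0%N.
  by move=> _ [n _ <-]; exact: max_diff_continuous.
move=> _ _ e [m _ <-] [n _ <-] e0; exists (max_diff (maxn m n)), e; split => //.
by move=> x y h; split; apply: le_lt_trans h; apply: le_max_diff;
  rewrite ?leq_maxl ?leq_maxr.
Qed.

(** The code of a point records the first [N] functions rounded down to multiples of the inverse of
    [k.+1], so points with equal codes are close. One point is chosen for each of the countably many
    codes, an arbitrary one if the code is not attained. *)
Lemma max_diff_separable N : separable_pseudometric (max_diff N).
Proof.
pose code k x := [seq Num.floor (phi n x * k.+1%:R) | n <- iota 0 N].
pose D (i : nat * seq int) := xget point [set x | code i.1 x = i.2].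
exists (fun n => D (odflt (0%N, [::]) (unpickle n))) => x e e0.
have [k ke] : exists k : nat, e^-1 < k.+1%:R.
  by exists (Num.trunc e^-1); exact: truncnS_gt.
exists (pickle (k, code k x)); rewrite pickleK /=.
set y := D _; have yx : code k y = code k x.
  by rewrite /y /D; apply: (@xgetPex _ point [set z | code k z = code k x]); exists x.
have : forall n, (n < N)%N -> `|phi n x - phi n y| < e.
  move=> n nN; have k0 : 0 < k.+1%:R :> R by rewrite ltr0n.
  have fl : Num.floor (phi n x * k.+1%:R) = Num.floor (phi n y * k.+1%:R).
    have := congr1 (fun s => nth 0 s n) yx.
    by rewrite !(nth_map 0%N) ?size_iota// !nth_iota.
  have /andP[h1 h2] := floor_itv (phi n x * k.+1%:R).
  have /andP[h3 h4] := floor_itv (phi n y * k.+1%:R).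
  have h : `|phi n x * k.+1%:R - phi n y * k.+1%:R| < 1.
    move: h1 h2 h3 h4; rewrite fl intrD.
    move: (phi n x * _) (phi n y * _) ((Num.floor _)%:~R) => a b c ? ? ? ?.
    by rewrite ltr_norml; apply/andP; split; lra.
  have : 1 < e * k.+1%:R by rewrite -ltr_pdivrMl// mulr1.
  move: h; rewrite -mulrBl normrM (gtr0_norm k0) => h h'.
  by rewrite -(ltr_pM2r k0); exact: lt_trans h h'.
elim: N {code D yx} y => [|n ih] y /= h; first by [].
by rewrite gt_max h ?ltnSn// andbT; apply: ih => m mn; apply: h; exact: ltnW.
Qed.

End separability.

(** * Topologies on the space of Radon charges *)

Section generating.
Context {R : realType} {X : ptopologicalType}.
Variable Pi : set (X -> X -> R).
Hypothesis gPi : generates_topology Pi.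

Lemma generates_continuous p : Pi p -> continuous_pseudometric p.
Proof.
have [gp _ gn] := gPi; move=> Pp; split; first exact: gp.
by move=> x e e0; apply/gn; exists p, e; split.
Qed.

Lemma generates_directed : directed_pseudometrics Pi.
Proof.
have [gp gd gn] := gPi; split => //; last exact: generates_continuous.
have /gn[p [e [Pp _ _]]] : nbhs (point : X) [set: X] by exact: filterT.
by exists p.
Qed.

(** If all pseudometrics vanish at [(x, y)], the two points lie in the same open sets, hence in the
    same Borel sets, since the sets that do not tell them apart form a sigma-algebra. This stands in
    for the Hausdorff property. *)
Lemma generates_separates (B : set (borel X)) x y : measurable B -> B x -> ~ B y ->
  exists2 q, Pi q & 0 < q x y.
Proof.
have [gp gd gn] := gPi; move=> mB Bx nBy; apply: contrapT => nq.
have q0 q : Pi q -> q x y = 0.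
  move=> Pq; apply/eqP; rewrite eq_le leNgt; apply/andP; split.
    by apply/negP => lt; apply: nq; exists q.
  by have [+ _ _ _] := gp q Pq; exact.
have same (C : set (borel X)) : measurable C -> (C x <-> C y).
  move: C; apply: smallest_sub; first split.
  - by [].
  - by move=> C h; rewrite !setTD; split=> + /h.
  - by move=> F h; split=> -[n _ /h ?]; exists n.
  - move=> U oU; split=> [Ux|Uy].
      have /gn[q [e [Pq e0]]] : nbhs x U by exact: open_nbhs_nbhs.
      by apply; rewrite /= q0.
    have /gn[q [e [Pq e0]]] : nbhs y U by exact: open_nbhs_nbhs.
    by apply; rewrite /=; have [_ _ -> _] := gp q Pq; rewrite q0.
by apply: nBy; exact/(same B mB).
Qed.

End generating.

Section determining_family.
Context {R : realType} {X : ptopologicalType}.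

Lemma bounded_continuous_measurable (f : X -> R) : bounded_continuous f ->
  bounded_measurable f.
Proof.
move=> [cf [M [_ MP]]]; split; first exact: continuous_measurable.
by exists (M + 1) => x; apply: MP => //; rewrite ltrDl.
Qed.

Lemma lip_bounded_continuous p C b (f : X -> R) : continuous_pseudometric p ->
  0 <= C -> lip p C f -> (forall x, `|f x| <= b) -> bounded_continuous f.
Proof.
move=> cp C0 lf fb; split; first exact: lip_continuous lf.
by exists b; split; [exact: num_real|move=> M bM x _; exact: le_trans (fb x) (ltW bM)].
Qed.

Lemma max_cones_bounded_continuous d (u : nat -> X) L : continuous_pseudometric d ->
  bounded_continuous (max_cones d u L : X -> R).
Proof.
move=> cd; have [b hb] := max_cones_bounded u L cd.1.
exact: lip_bounded_continuous cd ler01 (lip_max_cones u L cd.1) hb.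
Qed.

(** If [X] is separable, the cones of [p] itself suffice. Otherwise take the cones of all
    [max_diff phi N], which are unrelated to [p]: a charge that annihilates them annihilates all
    bounded Lipschitz functions of these pseudometrics, and since these separate points its total
    variation vanishes by [tv_approx]. *)
Lemma determining_family (Pi : set (X -> X -> R)) p : generates_topology Pi -> Pi p ->
  separable_space X \/ countably_separated (R := R) X ->
  exists g : nat -> X -> R, (forall n, bounded_continuous (g n)) /\
    forall nu : {charge set (borel X) -> \bar R}, radon nu ->
      (forall n, charge_integral nu (g n) = 0) ->
      forall f C b, 0 <= C -> lip p C f -> (forall x, `|f x| <= b) ->
        charge_integral nu f = 0.
Proof.
move=> gPi Pp; have cp := generates_continuous gPi Pp; case.
  move=> [D cD dD].
  have [u [_ uD]] := countable_sequence (point : X) cD.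
  exists (fun n => max_cones p u (odflt [::] (unpickle n))).
  split=> [n|nu rnu nu0 f C b C0 lf fb]; first exact: max_cones_bounded_continuous.
  apply: (@determining_lip R X p u nu C b f cp _ rnu _ C0 lf fb) => [x e e0|L].
    have [|y [/= xy Dy]] := dD [set y | p x y < e] _ (open_pseudometric_ball x e cp).
      by exists x => /=; have [_ -> _ _] := cp.1.
    by have [n un] := uD y Dy; exists n; rewrite un.
  by have := nu0 (pickle L); rewrite pickleK.
move=> [F [cF Fc Fsep]].
have [phi [phiF Fphi]] := countable_sequence (fun=> 0 : R) cF.
have cphi n : continuous (phi n).
  by case: (phiF n) => [/Fc//|->]; move=> x; exact: cvg_cst.
have /choice[u uP] (N : nat) := max_diff_separable phi N.
exists (fun n => let c := odflt (0%N, [::]) (unpickle n) in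
  max_cones (max_diff phi c.1) (u c.1) c.2).
split=> [n|nu rnu nu0 f C b C0 lf fb].
  by apply: max_cones_bounded_continuous; exact: max_diff_continuous.
have nuN N g D : 0 <= D -> lip (max_diff phi N) D g -> (forall x, `|g x| <= 1) ->
    charge_integral nu g = 0.
  move=> D0 lg g1.
  apply: (determining_lip (max_diff_continuous cphi N) (uP N) rnu _ D0 lg g1) => L.
  by have := nu0 (pickle (N, L)); rewrite pickleK.
have tv0 : tv nu setT <= 0.
  apply/ler_addgt0Pl => e e0; rewrite addr0 -subr_le0.
  have [|_ [D [g [[N _ <-] D0 lg g1]]]] :=
      tv_approx (max_diff_directed cphi) _ rnu e0.
    move=> B x y _ Bx nBy.
    have [|h Fh hxy] := Fsep x y; first by move=> xy; apply: nBy; rewrite -xy.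
    have [n pn] := Fphi h Fh.
    exists (max_diff phi n.+1); first by exists n.+1.
    by rewrite /= lt_max pn normr_gt0 subr_eq0; apply/orP; right; apply/eqP.
  by rewrite (nuN N g D).
have b0 : 0 <= b by exact: le_trans (normr_ge0 _) (fb point).
have bf := lip_bounded_measurable cp C0 lf fb.
apply/eqP; rewrite -normr_le0; apply: le_trans (le_charge_integral nu bf b0 fb) _.
by rewrite mulr_ge0_le0.
Qed.

End determining_family.

(** * The Kantorovich-Rubinstein seminorm *)

Section KR_seminorm.
Context {R : realType} {X : ptopologicalType}.
Variables (p : X -> X -> R) (cp : continuous_pseudometric p).
Implicit Types nu mu : {charge set (borel X) -> \bar R}.

Lemma Lip1_bounded_continuous f : Lip1 p f -> (forall x, `|f x| <= 1) ->
  bounded_continuous f.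
Proof.
move=> lf f1; apply: lip_bounded_continuous cp ler01 _ f1.
by move=> x y; rewrite mul1r; exact: lf.
Qed.

Lemma KR_seminorm_ge nu f : Lip1 p f -> (forall x, `|f x| <= 1) ->
  charge_integral nu f <= KR_seminorm p nu.
Proof.
move=> lf f1; apply: ub_le_sup; last by exists f.
exists (1 * tv nu setT) => _ [g [lg g1] <-].
apply: le_trans (ler_norm _) (le_charge_integral _ _ ler01 g1).
by apply: bounded_continuous_measurable; exact: Lip1_bounded_continuous.
Qed.

Lemma KR_seminorm_le nu e :
  (forall f, Lip1 p f -> (forall x, `|f x| <= 1) -> charge_integral nu f <= e) ->
  KR_seminorm p nu <= e.
Proof.
move=> h; apply: ge_sup; last by move=> _ [f [lf f1] <-]; exact: h.
exists (charge_integral nu (fun=> 0)), (fun=> 0) => //; split.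
  by move=> x y; rewrite subrr normr0; have [+ _ _ _] := cp.1; exact.
by move=> x; rewrite normr0.
Qed.

Lemma KR_seminorm_triangle lam mu nu :
  KR_seminorm p (csub lam nu) <= KR_seminorm p (csub lam mu) + KR_seminorm p (csub mu nu).
Proof.
apply: KR_seminorm_le => f lf f1.
have bf := bounded_continuous_measurable (Lip1_bounded_continuous lf f1).
have := KR_seminorm_ge (csub lam mu) lf f1; have := KR_seminorm_ge (csub mu nu) lf f1.
rewrite !charge_integral_csub//.
move: (KR_seminorm p _) (KR_seminorm p _) (charge_integral lam f)
  (charge_integral mu f) (charge_integral nu f) => a b c d t; lra.
Qed.

Lemma KR_seminorm_csubxx mu : KR_seminorm p (csub mu mu) <= 0.
Proof.
apply: KR_seminorm_le => f lf f1; rewrite charge_integral_csub ?subrr//.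
exact: bounded_continuous_measurable (Lip1_bounded_continuous lf f1).
Qed.

End KR_seminorm.

(** * Topologies generated by seminorms *)

Section seminorm_topology.
Context {R : realType} {X : ptopologicalType}.
Implicit Types (Q : set ({charge set (borel X) -> \bar R} -> R)).

Lemma seminorm_ball_open Q q (mu : radon_charge R X) (e : R) : Q q -> 0 < e ->
  open ([set nu : radon_charge R X | q (csub nu mu) < e] : set (seminorm_topology Q)).
Proof.
move=> Qq e0; set B := [set nu | _].
exists [set B]; last by rewrite bigcup_set1.
move=> _ ->; exists (finmap.fset1 B).
  by move=> C /finmap.fset1P ->; rewrite inE; exists q, mu, e.
by rewrite set_fset1 bigcap_set1.
Qed.

(** Open sets are unions of finite intersections of balls, so balls containing [mu] are enough.
    Their centres [nu] are arbitrary, as in the subbase. *)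
Lemma seminorm_topology_filter Q (F : set_system (radon_charge R X))
    (mu : radon_charge R X) (U : set (seminorm_topology Q)) : Filter F ->
  (forall q (nu : radon_charge R X) e, Q q -> 0 < e -> q (csub mu nu) < e ->
    F [set lam | q (csub lam nu) < e]) ->
  open U -> U mu -> F U.
Proof.
move=> FF FB [D' sD' <-] [B D'B Bmu].
have [fs fsQ Bfs] := sD' B D'B.
apply: (@filterS _ F _ B); first by move=> nu Bnu; exists B.
rewrite -Bfs; apply: filter_bigI => C Cfs.
have := fsQ C Cfs; rewrite inE => -[q [nu [e [Qq e0 CE]]]].
rewrite CE; apply: FB => //.
have : C mu by move: Bmu; rewrite -Bfs; apply.
by rewrite CE.
Qed.

(** Adding the complement of [A] to [U] does not change its trace; the interior of this larger set
    for the second topology is the open set sought. *)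
Lemma sub_trace_opens Q1 Q2 (A : set (radon_charge R X)) :
  (forall (mu : radon_charge R X) (U : set (seminorm_topology Q1)),
    A mu -> open U -> U mu ->
    nbhs (mu : seminorm_topology Q2)
      ([set nu | A nu -> U nu] : set (radon_charge R X))) ->
  trace_opens (A : set (seminorm_topology Q1)) `<=`
  trace_opens (A : set (seminorm_topology Q2)).
Proof.
move=> h _ [U oU <-].
exists (interior ([set nu | A nu -> U nu] : set (seminorm_topology Q2))).
  exact: open_interior.
apply/seteqP; split=> mu [Amu mU]; split => //.
  exact: (interior_subset mU) Amu.
exact: h.
Qed.

End seminorm_topology.

(** * Comparison of the two topologies on a weakly compact set *)

Section weak_and_KR.
Context {R : realType} {X : ptopologicalType}.
Variables (Pi : set (X -> X -> R)) (gPi : generates_topology Pi).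
Implicit Types (mu nu : radon_charge R X) (A : set (radon_charge R X)).

Lemma weak_ball_nbhs f mu (e : R) : bounded_continuous f -> 0 < e ->
  nbhs (mu : weak_topology R X)
    ([set nu | `|charge_integral nu f - charge_integral mu f| < e]
      : set (radon_charge R X)).
Proof.
move=> bcf e0; have bf := bounded_continuous_measurable bcf.
pose Q : set ({charge set (borel X) -> \bar R} -> R) :=
  [set (fun lam => `|charge_integral lam f|) | f in bounded_continuous].
have Qf : Q (fun lam => `|charge_integral lam f|) by exists f.
have oB := seminorm_ball_open mu Qf e0.
apply: (@filterS _ (nbhs (mu : weak_topology R X)) _
  [set nu : radon_charge R X | `|charge_integral (csub nu mu) f| < e]).
  by move=> nu /=; rewrite charge_integral_csub.
apply: open_nbhs_nbhs; split; first exact: oB.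
by rewrite /= charge_integral_csub// subrr normr0.
Qed.

Lemma KR_ball_nbhs p mu (e : R) : Pi p -> 0 < e ->
  nbhs (mu : KR_topology Pi)
    ([set nu | KR_seminorm p (csub nu mu) < e] : set (radon_charge R X)).
Proof.
move=> Pp e0; have Qp : [set @KR_seminorm R X p | p in Pi] (KR_seminorm p) by exists p.
apply: open_nbhs_nbhs; split; first exact: (seminorm_ball_open mu Qp e0).
exact: le_lt_trans (KR_seminorm_csubxx (generates_continuous gPi Pp) mu) e0.
Qed.

(** A sequence in [A] with unbounded integrals would cluster weakly at some [nu], but near [nu] the
    integrals of [f] stay within 1 of that of [nu]. *)
Lemma weakly_compact_bounded A f : weakly_compact A -> bounded_continuous f ->
  exists M, forall nu, A nu -> `|charge_integral nu f| <= M.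
Proof.
move=> cA bcf; apply: contrapT => nM.
have /choice[s sP] (n : nat) : exists nu, A nu /\ n%:R < `|charge_integral nu f|.
  apply: contrapT => h; apply: nM; exists n%:R => nu Anu.
  by rewrite leNgt; apply/negP => lt; apply: h; exists nu.
have FF : ProperFilter (s @ \oo) by apply: fmap_proper_filter.
have FA : (s @ \oo) A by exists 0%N => // n _; exact: (sP n).1.
have [nu [_ cl]] := cA _ FF FA.
have [K Kb] : exists K : nat, `|charge_integral nu f| + 1 < K%:R.
  by exists (Num.trunc (`|charge_integral nu f| + 1)).+1; exact: truncnS_gt.
have FK : (s @ \oo) [set s n | n in [set n | (K <= n)%N]].
  by exists K => // n Kn /=; exists n.
have [_ [[n Kn <-] /= near]] := cl _ _ FK (weak_ball_nbhs nu bcf ltr01).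
have [_ big] := sP n.
have : K%:R <= n%:R :> R by rewrite ler_nat.
have := ler_distD (charge_integral nu f) (charge_integral (s n) f) 0.
rewrite !subr0 => ? ?; lra.
Qed.

Lemma tv_weakly_compact A : weakly_compact A ->
  exists M, forall nu, A nu -> tv nu setT <= M.
Proof.
move=> cA.
have [||M MP] := @tv_bounded R X Pi
    (fun lam => exists2 nu : radon_charge R X, A nu & lam = nu)
    (generates_directed gPi) (generates_separates gPi).
- by move=> _ [a _ ->]; exact: charge_of_radon.
- move=> f cf bf; have [M MP] := weakly_compact_bounded cA (conj cf bf).
  by exists M => _ [a Aa ->]; exact: MP.
by exists M => nu Anu; apply: MP; exists nu.
Qed.

(* By compactness, convergence on the determining family forces convergence on
   every bounded Lipschitz function. *)
Lemma determining_convergence A mu p (g : nat -> X -> R) (s : nat -> radon_charge R X) :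
  weakly_compact A -> continuous_pseudometric p ->
  (forall n, bounded_continuous (g n)) ->
  (forall lam : {charge set (borel X) -> \bar R}, radon lam ->
    (forall n, charge_integral lam (g n) = 0) ->
    forall f C b, 0 <= C -> lip p C f -> (forall x, `|f x| <= b) ->
      charge_integral lam f = 0) ->
  (forall k, A (s k)) ->
  (forall k i, (i < k)%N ->
    `|charge_integral (s k) (g i) - charge_integral mu (g i)| < k.+1%:R^-1) ->
  forall f C b, 0 <= C -> lip p C f -> (forall x, `|f x| <= b) -> forall e, 0 < e ->
  exists N, forall k, (N <= k)%N -> `|charge_integral (csub (s k) mu) f| <= e.
Proof.
move=> cA cp bg det As sg f C b C0 lf fb e e0; apply: contrapT => nN.
have bcf := lip_bounded_continuous cp C0 lf fb.
have bf := bounded_continuous_measurable bcf.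
(* Only the indices that violate the conclusion are kept, so a cluster point [nu] along them should
   violate it too. But [nu] agrees with [mu] on every [g i], hence on [f]. *)
pose D := [set k | e < `|charge_integral (csub (s k) mu) f|].
have FD : ProperFilter (within D \oo).
  apply: Build_ProperFilter_ex => P [N _ NP]; apply: contrapT => nP; apply: nN.
  exists N => k Nk; rewrite leNgt; apply/negP => Dk.
  by apply: nP; exists k; exact: NP Nk Dk.
have FF : ProperFilter (s @ within D \oo) by apply: fmap_proper_filter.
have FA : (s @ within D \oo) A by exists 0%N => // k _ _; exact: As.
have [nu [_ cl]] := cA _ FF FA.
have tail K : (s @ within D \oo) [set s k | k in [set k | (K <= k)%N /\ D k]].
  by exists K => // k Kk Dk /=; exists k.
have nu0 : charge_integral (csub nu mu) f = 0.
  apply: (det _ _ _ f C b) => // [|i]; first by apply: radon_csub; exact: charge_of_radon.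
  have bgi := bounded_continuous_measurable (bg i).
  rewrite charge_integral_csub//; apply/eqP; rewrite -normr_le0.
  apply/ler_addgt0Pl => t t0; rewrite addr0.
  have t2 : 0 < t / 2 by rewrite divr_gt0.
  have [K Kt] : exists K : nat, (t / 2)^-1 < K%:R.
    by exists (Num.trunc (t / 2)^-1).+1; exact: truncnS_gt.
  have [_ [[k [Kk _] <-] /= near]] :=
    cl _ _ (tail (maxn K i.+1)) (weak_ball_nbhs nu (bg i) t2).
  have ik := sg k i (leq_trans (leq_maxr K i.+1) Kk).
  have kt : k.+1%:R^-1 <= t / 2.
    rewrite -[leRHS]invrK lef_pV2 ?posrE ?invr_gt0//.
    apply: le_trans (ltW Kt) _; rewrite ler_nat.
    by apply: leqW; exact: leq_trans (leq_maxl K i.+1) Kk.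
  have := ler_distD (charge_integral (s k) (g i)) (charge_integral nu (g i))
    (charge_integral mu (g i)).
  move: near ik; rewrite (distrC (charge_integral nu _) (charge_integral (s k) _)).
  move: (`|charge_integral (s k) (g i) - _|) (`|charge_integral (s k) (g i) - _|)
    (`|charge_integral nu (g i) - _|) (k.+1%:R^-1) kt => x y z w *; lra.
have [_ [[k [_ Dk] <-] /= near]] := cl _ _ (tail 0%N) (weak_ball_nbhs nu bcf e0).
move: Dk nu0 near; rewrite /D /= !charge_integral_csub// => Dk /eqP.
by rewrite subr_eq0 => /eqP -> h; have := lt_trans h Dk; rewrite ltxx.
Qed.

(** Otherwise, for each [k], some [s k] in [A] is far from [mu] in the seminorm yet within the
    inverse of [k.+1] of it on the first [k] determining functions. The differences [csub (s k) mu]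
    have bounded variation and tend to 0 on each bounded Lipschitz function, hence uniformly on the
    unit ones. *)
Lemma KR_ball_weak_nbhs A mu p (e : R) : weakly_compact A -> A mu ->
  separable_space X \/ countably_separated (R := R) X -> Pi p -> 0 < e ->
  nbhs (mu : weak_topology R X)
    ([set nu | A nu -> KR_seminorm p (csub nu mu) < e] : set (radon_charge R X)).
Proof.
move=> cA Amu sX Pp e0; apply: contrapT => nU.
have cp := generates_continuous gPi Pp.
have [g [bg det]] := determining_family gPi Pp sX.
have /choice[s sP] (k : nat) : exists nu, [/\ A nu, e <= KR_seminorm p (csub nu mu) &
    forall i, (i < k)%N ->
    `|charge_integral nu (g i) - charge_integral mu (g i)| < k.+1%:R^-1].
  apply: contrapT => h; apply: nU.
  have k0 : 0 < k.+1%:R^-1 :> R by rewrite invr_gt0.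
  have : nbhs (mu : weak_topology R X) ([set nu | forall i, (i < k)%N ->
      `|charge_integral nu (g i) - charge_integral mu (g i)| < k.+1%:R^-1]
      : set (radon_charge R X)).
    elim: {1}k => [|j ih]; first by apply: filterS filterT => nu _ i.
    apply: filterS2 ih (weak_ball_nbhs mu (bg j) k0) => nu /= h1 h2 i.
    by rewrite ltnS leq_eqVlt => /predU1P[->|/h1].
  apply: filterS => nu /= nug Anu; rewrite ltNge; apply/negP => le.
  by apply: h; exists nu.
have [M MP] := tv_weakly_compact cA.
have rs k : radon (csub (s k) mu) by apply: radon_csub; exact: charge_of_radon.
have sM k : tv (csub (s k) mu) setT <= M + M.
  apply: le_trans (tv_csub _ _ measurableT) (lerD (MP _ _) (MP _ Amu)).
  by have [] := sP k.
have e2 : 0 < e / 2 by rewrite divr_gt0.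
have As k : A (s k) by have [] := sP k.
have sg k : forall i, (i < k)%N ->
    `|charge_integral (s k) (g i) - charge_integral mu (g i)| < k.+1%:R^-1.
  by have [] := sP k.
have [N NP] := lip_uniform_convergence cp rs sM
  (determining_convergence cA cp bg det As sg) e2.
have [_ big _] := sP N.
have : KR_seminorm p (csub (s N) mu) <= e / 2.
  by apply: KR_seminorm_le cp _ _ _ => f lf f1; exact: NP.
by move=> le; have := le_trans big le; rewrite leNgt ltr_pdivrMr// ltr_pMr// ltr1n.
Qed.

Lemma KR_open_weak_nbhs A mu (U : set (KR_topology Pi)) : weakly_compact A -> A mu ->
  separable_space X \/ countably_separated (R := R) X -> open U -> U mu ->
  nbhs (mu : weak_topology R X) ([set nu | A nu -> U nu] : set (radon_charge R X)).
Proof.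
move=> cA Amu sX oU Umu.
apply: (@seminorm_topology_filter R X [set @KR_seminorm R X p | p in Pi]
    (within A (nbhs (mu : weak_topology R X))) mu U) => //.
move=> _ nu e [p Pp <-] e0 munu.
have d0 : 0 < e - KR_seminorm p (csub mu nu) by rewrite subr_gt0.
apply: filterS (KR_ball_weak_nbhs cA Amu sX Pp d0) => lam /= h Alam.
apply: le_lt_trans (KR_seminorm_triangle (generates_continuous gPi Pp) lam mu nu) _.
by rewrite -ltrBrDr; exact: h.
Qed.

(** Distinct elements of the type may differ only off the Borel sets, so the weak topology need not
    separate them. Points are told apart by their integrals instead. *)
Lemma weak_inseparable_open mu nu (U : set (weak_topology R X)) : open U -> U mu ->
  (forall f, bounded_continuous f -> charge_integral nu f = charge_integral mu f) ->
  U nu.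
Proof.
move=> oU Umu eqf.
apply: (@seminorm_topology_filter R X
    [set (fun lam => `|charge_integral lam f|) | f in bounded_continuous]
    (principal_filter nu) mu U) => //.
move=> _ lam e [f bcf <-] e0 /=; have bf := bounded_continuous_measurable bcf.
rewrite charge_integral_csub// => lt; apply/principal_filterP.
by rewrite /= charge_integral_csub// eqf.
Qed.

(** Otherwise the KR neighbourhoods of [mu] trace a proper filter on the part of [A] outside [U],
    with a weak cluster point [nu] in [A] outside [U]. Some integral, hence by [tv_approx] that of a
    Lipschitz function, distinguishes [nu] from [mu]; but along the filter this integral tends to
    its value at [mu] and clusters at its value at [nu]. *)
Lemma weak_open_KR_nbhs A mu (U : set (weak_topology R X)) : weakly_compact A ->
  A mu -> open U -> U mu ->
  nbhs (mu : KR_topology Pi) ([set nu | A nu -> U nu] : set (radon_charge R X)).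
Proof.
move=> cA Amu oU Umu; apply: contrapT => nU.
pose D : set (radon_charge R X) := A `\` U.
have FF : ProperFilter (within D (nbhs (mu : KR_topology Pi))).
  apply: Build_ProperFilter_ex => P nP; apply: contrapT => nex; apply: nU.
  have {}nP : nbhs (mu : KR_topology Pi) [set nu | D nu -> P nu] := nP.
  apply: filterS nP => nu nuP Anu; apply: contrapT => nUnu.
  by apply: nex; exists nu; apply: nuP.
have FD : within D (nbhs (mu : KR_topology Pi)) D.
  exact: withinT.
have FA : within D (nbhs (mu : KR_topology Pi)) A by apply: filterS FD => nu [].
have [nu [Anu cl]] := cA _ FF FA.
have nUnu : ~ U nu.
  move=> Unu; have nbU : nbhs (nu : weak_topology R X) U by exact: open_nbhs_nbhs.
  by have [lam [[_ nUl] Ul]] := cl _ _ FD nbU.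
have [f bcf nuf] : exists2 f, bounded_continuous f &
    charge_integral nu f <> charge_integral mu f.
  apply: contrapT => h; apply: nUnu; apply: (weak_inseparable_open oU Umu) => f bcf.
  by apply: contrapT => ne; apply: h; exists f.
have rc : radon (csub nu mu) by apply: radon_csub; exact: charge_of_radon.
have tv0 : 0 < tv (csub nu mu) setT.
  rewrite lt_neqAle tv_ge0 andbT; apply/eqP => tvE; apply: nuf.
  have [mf [b fb]] := bounded_continuous_measurable bcf.
  have b0 : 0 <= b by exact: le_trans (normr_ge0 _) (fb point).
  have bf : bounded_measurable f by split=> //; exists b.
  have := le_charge_integral (csub nu mu) bf b0 fb.
  by rewrite -tvE mulr0 normr_le0 charge_integral_csub// subr_eq0 => /eqP.
have t2 : 0 < tv (csub nu mu) setT / 2 by rewrite divr_gt0.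
have [q [C [g [Pq C0 lg g1 gt]]]] :=
  tv_approx (generates_directed gPi) (generates_separates gPi) rc t2.
have cq := generates_continuous gPi Pq.
have bg := lip_bounded_measurable cq C0 lg g1.
have C1 : 0 < C + 1 by lra.
have Ci : 0 <= (C + 1)^-1 by rewrite invr_ge0 ltW.
(* Division by [C + 1] makes the Lipschitz constant at most 1 and keeps the bound 1, as the seminorm
   requires. *)
pose h x := (C + 1)^-1 * g x.
have lh : Lip1 q h.
  move=> x y; rewrite -mulrBr normrM ger0_norm// mulrC ler_pdivrMr//.
  apply: le_trans (lg x y) _; rewrite mulrC ler_wpM2l//; last by lra.
  by have [[+ _ _ _] _] := cq; exact.
have h1 x : `|h x| <= 1.
  rewrite normrM ger0_norm// mulrC ler_pdivrMr//.
  by apply: le_trans (g1 x) _; lra.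
have bch := Lip1_bounded_continuous cq lh h1.
have bh := bounded_continuous_measurable bch.
have Ih : 0 < charge_integral nu h - charge_integral mu h.
  rewrite -charge_integral_csub// charge_integralZ// mulr_gt0 ?invr_gt0//.
  apply: lt_le_trans gt; rewrite subr_gt0 ltr_pdivrMr// ltr_pMr// ltr1n//.
set d := _ - _ in Ih; have d2 : 0 < d / 2 by rewrite divr_gt0.
have FB : within D (nbhs (mu : KR_topology Pi))
    [set lam : radon_charge R X | KR_seminorm q (csub lam mu) < d / 2].
  exact: cvg_within (KR_ball_nbhs mu Pq d2).
have [lam [/= lmu lnu]] := cl _ _ FB (weak_ball_nbhs nu bch d2).
have := le_lt_trans (KR_seminorm_ge cq (csub lam mu) lh h1) lmu.
rewrite charge_integral_csub//; move: lnu; rewrite /d ltr_norml => /andP[+ _].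
move: (charge_integral lam h) (charge_integral mu h) (charge_integral nu h) => a b c.
lra.
Qed.

End weak_and_KR.

Theorem proposition2p3 (R : realType) (X : ptopologicalType)
    (Pi : set (X -> X -> R)) :
  completely_regular_space X ->
  generates_topology Pi ->
  separable_space X \/ countably_separated (R := R) X ->
  forall A : set (radon_charge R X),
    weakly_compact A ->
    trace_opens (A : set (weak_topology R X))
      = trace_opens (A : set (KR_topology Pi)).
Proof.
move=> _ gPi sX A cA; apply/seteqP; split.
- apply: (@sub_trace_opens R X
    [set (fun lam => `|charge_integral lam f|) | f in bounded_continuous]
    [set @KR_seminorm R X p | p in Pi]) => mu U Amu oU Umu.
  exact: weak_open_KR_nbhs.
- apply: (@sub_trace_opens R X [set @KR_seminorm R X p | p in Pi]
    [set (fun lam => `|charge_integral lam f|) | f in bounded_continuous])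
    => mu U Amu oU Umu.
  exact: KR_open_weak_nbhs.
Qed.
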